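(* Let $n\ge1$ be an integer and let $A$ be any alternating $n$-quasigroup. If $g$ is the standard metric on the open serenation $\mathrm{OSer}_n(A)$, then the Riemannian manifold $(\mathrm{OSer}_n(A),g)$ is flat.
   Context: **Manifolds.** A manifold is a finite-dimensional real manifold without boundary which is a disjoint union of an arbitrary number of second countable connected components; the empty manifold is allowed. **Alternating quasigroups.** An $n$-quasigroup is a set $A$ with an operation $f\colon A^n\to A$ such that for every $i\in\{1,\dots,n\}$ and all $x_1,\dots,x_{i-1},x_{i+1},\dots,x_n,y\in A$ there is a unique $x_i\in A$ with $f(x_1,\dots,x_n)=y$. It is alternating if $f(x_1,\dots,x_n)=f(x_{\alpha(1)},\dots,x_{\alpha(n)})$ for all $x\in A^n$ and all even permutations $\alpha$ of $\{1,\dots,n\}$. A tuple $a\in A^n$ commutes if $f(a)=f(a_{\sigma(1)},\dots,a_{\sigma(n)})$ for all permutations $\sigma$ of $\{1,\dots,n\}$. Let $\mathrm{NCT}(A)\subseteq A^n$ be the set of tuples that do not commute. **The space $\mathrm{OSer}_n(A)$.** Let $\mathrm{In}(A)$ be the set of entries of tuples in $\mathrm{NCT}(A)$ and $\mathrm{Out}(A)=\{f(a): a\in\mathrm{NCT}(A)\}$. Let $V=\{\underline{x}:x\in\mathrm{In}(A)\}\sqcup\{\overline{x}:x\in\mathrm{Out}(A)\}$ (a disjoint union of formal copies). Let $\mathrm{Sim}_n(A)$ be the simplicial complex on $V$ whose faces are all subsets of the sets $\{\underline{a}_1,\dots,\underline{a}_n,\overline{f(a)}\}$, $a\in\mathrm{NCT}(A)$.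 View $V$ as the standard basis of $\mathbb{R}^V$, and let $\mathrm{OCvx}(X)$ be the interior of the convex hull of $X$ in its affine hull. As a topological space the open serenation $\mathrm{OSer}_n(A)\subseteq\mathbb{R}^V$ is the union of $\mathrm{OCvx}(\gamma)$ over all faces $\gamma$ of $\mathrm{Sim}_n(A)$ with $|\gamma|\in\{n,n+1\}$, with the subspace topology. **Smooth structure.** Let $\mathrm{Bipyr}_n=\mathrm{OCvx}(\{0,(\tfrac2n,\dots,\tfrac2n),e_1,\dots,e_n\})\subset\mathbb{R}^n$. For $a\in\mathrm{NCT}(A)$ let $a'$ be obtained from $a$ by swapping two entries, and let $a_{n+1}\in A$ be the unique element with $f(a_1,\dots,a_{n-2},a_{n+1},a_{n-1})=f(a)$. For $u\in\mathbb{R}^n$ put $|u|=\sum_{i=1}^n u_i$ and $v_i=\frac2n\big(1+\frac{n-2}{2}u_i-\sum_{j\ne i}u_j\big)$. The charts (parametrizations with domain $\mathrm{Bipyr}_n$) are: the input chart $\underline{\phi}_a(u)=\sum_{i=1}^n u_i\underline{a}_i+(1-|u|)\overline{f(a)}$ if $|u|\le1$, and $\underline{\phi}_a(u)=\sum_{i=1}^n v_i\underline{a}_i+(|u|-1)\overline{f(a')}$ if $|u|>1$; and the output chart $\overline{\phi}_a(u)=\sum_{i=1}^{n-1}u_i\underline{a}_i+u_n\overline{f(a)}+(1-|u|)\underline{a}_n$ if $|u|\le1$, and $\overline{\phi}_a(u)=\sum_{i=1}^{n-1}v_i\underline{a}_i+v_n\overline{f(a)}+(|u|-1)\underline{a}_{n+1}$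 if $|u|>1$. The smooth atlas of $\mathrm{OSer}_n(A)$ consists of all $\underline{\phi}_a,\overline{\phi}_a$ for $a\in\mathrm{NCT}(A)$. **Standard metric.** The standard Riemannian metric $g$ on $\mathrm{OSer}_n(A)$ is the bilinear extension of the following rules, where $\delta$ is the Kronecker delta. (1) If $x\in\mathrm{OCvx}(\{\underline{a}_1,\dots,\underline{a}_n,\overline{f(a)}\})$, then $T_x$ is identified with the span of the $\underline{a}_i-\overline{f(a)}$ in $\mathbb{R}^V$, and $g_x(\underline{a}_i-\overline{f(a)},\underline{a}_j-\overline{f(a)})=1+\delta_{ij}$. (2) If $x\in\mathrm{OCvx}(\{\underline{a}_1,\dots,\underline{a}_{n-1},\overline{f(a)}\})$, denote the coordinate tangent vectors $\partial/\partial u_1,\dots,\partial/\partial u_n$ of $\overline{\phi}_a$ at $x$ by $\underline{a}_1,\dots,\underline{a}_{n-1},\overline{f(a)}$; then $g_x(\underline{a}_i,\underline{a}_j)=1+\delta_{ij}$, $g_x(\underline{a}_i,\overline{f(a)})=1$, $g_x(\overline{f(a)},\overline{f(a)})=2$. (3) If $x\in\mathrm{OCvx}(\{\underline{a}_1,\dots,\underline{a}_n\})$, denote the coordinate tangent vectors of $\underline{\phi}_a$ at $x$ by $\underline{a}_1,\dots,\underline{a}_n$; then $g_x(\underline{a}_i,\underline{a}_j)=1+\delta_{ij}$. *)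

(* Defs.v *)
From HB Require Import structures.
From mathcomp Require Import all_boot all_order all_algebra all_fingroup.
From mathcomp Require Import all_classical all_reals all_analysis.

Set Implicit Arguments.
Unset Strict Implicit.
Unset Printing Implicit Defensive.

Import Order.TTheory GRing.Theory Num.Theory.
Import numFieldNormedType.Exports.

Local Open Scope classical_set_scope.
Local Open Scope ring_scope.

Section OpenConvexHull.
Context {R : realType} {E : preTopologicalLmodType R}.
Implicit Type X : set E.

Definition affine_hull X : set E :=
  [set x | exists (m : nat) (p : 'I_m -> E) (c : 'I_m -> R),
     [/\ forall i, X (p i), \sum_i c i = 1 & x = \sum_i c i *: p i]].

Definition convex_hull X : set E :=
  [set x | exists (m : nat) (p : 'I_m -> E) (c : 'I_m -> R),
     [/\ forall i, X (p i), forall i, 0 <= c i, \sum_i c i = 1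
       & x = \sum_i c i *: p i]].

(* The interior of the convex hull relative to the affine hull. *)
Definition OCvx X : set E :=
  [set x | affine_hull X x /\ within (affine_hull X) (nbhs x) (convex_hull X)].

End OpenConvexHull.

Section Smooth.
Context {R : realType} {n : nat}.

Definition partial (i : 'I_n) (h : 'rV[R]_n -> R) : 'rV[R]_n -> R :=
  'D_(delta_mx 0 i) h.

(* C^oo: every iterated partial derivative is (Frechet) differentiable on W. *)
Definition smooth_on (W : set 'rV[R]_n) (h : 'rV[R]_n -> R) : Prop :=
  forall (s : seq 'I_n) u, W u -> differentiable (foldr partial h s) u.

End Smooth.

(* M is a subspace of the ambient space E, and all the parametrizations in Phi
   have the same domain D, a subset of R^n. *)
Section Manifold.
Context {R : realType} {n : nat} {E : topologicalType}.
Variables (M : set E) (D : set 'rV[R]_n) (Phi : set ('rV[R]_n -> E)).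
Implicit Types (phi psi : 'rV[R]_n -> E) (u : 'rV[R]_n) (x : E).

(* phi restricts to a homeomorphism from D onto an open subset of M. *)
Definition parametrization phi : Prop :=
  [/\ set_inj D phi, phi @` D `<=` M, {within D, continuous phi}
    & forall W, open W -> W `<=` D ->
        exists2 U, open U & phi @` W = U `&` M].

(* psi^-1 \o phi, meaningful on D `&` phi @^-1` (psi @` D). *)
Definition transition phi psi u : 'rV[R]_n :=
  xget 0 [set w | D w /\ psi w = phi u].

(* Components, rather than M itself, are required to be second countable. *)
Definition smooth_manifold : Prop :=
  [/\ hausdorff_space (set_type M),
      forall x, M x -> @second_countable (set_type (connected_component M x)),
      open D,
      (forall phi, Phi phi -> parametrization phi) /\
        M = \bigcup_(phi in Phi) (phi @` D)
    & forall phi psi, Phi phi -> Phi psi -> forall i : 'I_n,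
        smooth_on (D `&` phi @^-1` (psi @` D))
                  (fun u => transition phi psi u 0 i)].

(* A tangent vector at x is encoded by its coordinates in every
   parametrization around x; they transform by the Jacobian matrices of the
   transition maps (acting on row vectors).  Parametrizations whose image does
   not contain x carry the dummy value 0. *)
Definition tvec : Type := ('rV[R]_n -> E) -> 'rV[R]_n.

Definition tangent x (X : tvec) : Prop :=
  (forall phi, ~ (Phi phi /\ (phi @` D) x) -> X phi = 0) /\
  (forall phi psi u, Phi phi -> Phi psi -> D u -> phi u = x ->
     (psi @` D) x -> X psi = X phi *m 'J (transition phi psi) u).

Definition tvec_add (X Y : tvec) : tvec := fun phi => X phi + Y phi.
Definition tvec_scale (c : R) (X : tvec) : tvec := fun phi => c *: X phi.

(* The coordinate tangent vector d/du_i of phi at the point phi u. *)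
Definition coord_tvec phi u (i : 'I_n) : tvec := fun psi =>
  if `[< Phi psi /\ (psi @` D) (phi u) >]
  then row i ('J (transition phi psi) u) else 0.

(* g x X Y is only relevant for x in M and X, Y tangent at x. *)
Variable g : E -> tvec -> tvec -> R.

Definition bilinear_at x : Prop :=
  (forall (c : R) X Y Z, tangent x X -> tangent x Y -> tangent x Z ->
     g x (tvec_add (tvec_scale c X) Y) Z = c * g x X Z + g x Y Z) /\
  (forall (c : R) X Y Z, tangent x X -> tangent x Y -> tangent x Z ->
     g x Z (tvec_add (tvec_scale c X) Y) = c * g x Z X + g x Z Y).

Definition gram phi u : 'M[R]_n :=
  \matrix_(i, j) g (phi u) (coord_tvec phi u i) (coord_tvec phi u j).

Definition riemannian_metric : Prop :=
  [/\ forall x, M x -> bilinear_at x,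
      forall x X Y, M x -> tangent x X -> tangent x Y -> g x X Y = g x Y X,
      forall x X, M x -> tangent x X -> X <> (fun=> 0) -> 0 < g x X X
    & forall phi, Phi phi -> forall i j : 'I_n,
        smooth_on D (fun u => gram phi u i j)].

Definition riemannian_manifold : Prop :=
  smooth_manifold /\ riemannian_metric.

(* Gamma^k_ij of the Levi-Civita connection, in the coordinates of phi. *)
Definition christoffel phi (k i j : 'I_n) u : R :=
  2^-1 * \sum_l invmx (gram phi u) k l *
    (partial i (fun w => gram phi w j l) u
     + partial j (fun w => gram phi w i l) u
     - partial l (fun w => gram phi w i j) u).

(* The component R^l_kij of the Riemann curvature tensor, that is the l-th
   component of R(d_i, d_j) d_k, in the coordinates of phi. *)
Definition curvature phi (l k i j : 'I_n) u : R :=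
  partial i (christoffel phi l j k) u - partial j (christoffel phi l i k) u
  + \sum_m (christoffel phi l i m u * christoffel phi m j k u
            - christoffel phi l j m u * christoffel phi m i k u).

Definition flat : Prop :=
  forall phi u, Phi phi -> D u -> forall l k i j, curvature phi l k i j u = 0.

End Manifold.

Section Quasigroup.
Context {n : nat} {A : Type}.
Variable f : ('I_n -> A) -> A.
Implicit Type a : 'I_n -> A.

Definition quasigroup : Prop :=
  forall (i : 'I_n) a y, exists! z, f [eta a with i |-> z] = y.

Definition alternating_op : Prop :=
  forall a (s : 'S_n), ~~ odd_perm s -> f a = f (a \o s).

Definition commutes a : Prop := forall s : 'S_n, f a = f (a \o s).

Definition NCT : set ('I_n -> A) := [set a | ~ commutes a].

Definition In : set A := [set x | exists2 a, NCT a & exists i, a i = x].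
Definition Out : set A := f @` NCT.

(* From a_1, .., a_n and z, the tuple (a_1, .., a_(n-2), z, a_(n-1)). *)
Definition shift_insert a (z : A) : 'I_n -> A := fun i =>
  if i.+2 == n then z else if i.+1 == n then a (ord_pred i) else a i.

(* z is the element written a_(n+1). *)
Definition opposite_entry a (z : A) : Prop := f (shift_insert a z) = f a.

Definition vertex : Type := (set_type In + set_type Out)%type.

Definition top_face a : set vertex := [set v | match v with
  | inl x => exists i, \val x = a i
  | inr y => \val y = f a
  end].

Definition face (gamma : set vertex) : Prop :=
  exists2 a, NCT a & gamma `<=` top_face a.

End Quasigroup.

Definition pw_space (R : realType) (V : Type) : Type := {ptws V -> R}.

Section PwSpace.
Variables (R : realType) (V : Type).
HB.instance Definition _ :=
  GRing.Lmodule.copy (pw_space R V) (V -> R).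
HB.instance Definition _ :=
  Topological.copy (pw_space R V) {ptws V -> R}.
End PwSpace.

Section Serenation.
Variables (R : realType) (n : nat) (A : Type) (f : ('I_n -> A) -> A).
Implicit Type a : 'I_n -> A.

Local Notation E := (pw_space R (vertex f)).

Definition basis_vec (v : vertex f) : E := fun w => (`[< w = v >])%:R.

(* The basis vectors of the two copies of x; they are 0, and not used, when x
   is not in In f, respectively Out f. *)
Definition lower_vec (x : A) : E := fun w =>
  if w is inl y then (`[< \val y = x >])%:R else 0.
Definition upper_vec (x : A) : E := fun w =>
  if w is inr y then (`[< \val y = x >])%:R else 0.

Definition OSer : set E := [set x | exists gamma : set (vertex f),
  [/\ face gamma, (gamma #= `I_n)%card \/ (gamma #= `I_n.+1)%card
    & OCvx (basis_vec @` gamma) x]].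

Definition Bipyr : set 'rV[R]_n :=
  @OCvx R ('rV[R]_n : normedModType R)
    ([set 0; const_mx (2 / n%:R)] `|` range (fun i : 'I_n => delta_mx 0 i)).

Definition coord_sum (u : 'rV[R]_n) : R := \sum_i u 0 i.

Definition reflected (u : 'rV[R]_n) (i : 'I_n) : R :=
  2 / n%:R * (1 + (n%:R - 2) / 2 * u 0 i - \sum_(j | j != i) u 0 j).

(* The common form of the input and output charts: the equator of Bipyr goes
   to the simplex spanned by e, and the two apices to p and q. *)
Definition bipyr_chart (e : 'I_n -> E) (p q : E) (u : 'rV[R]_n) : E :=
  if coord_sum u <= 1
  then \sum_i u 0 i *: e i + (1 - coord_sum u) *: p
  else \sum_i reflected u i *: e i + (coord_sum u - 1) *: q.

(* a' is a with two entries swapped. *)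
Definition in_chart a a' : 'rV[R]_n -> E :=
  bipyr_chart (lower_vec \o a) (upper_vec (f a)) (upper_vec (f a')).

(* a_1, .., a_(n-1) and f(a), in this order. *)
Definition out_facet a (i : 'I_n) : E :=
  if i.+1 == n then upper_vec (f a) else lower_vec (a i).

Definition out_chart a (last z : A) : 'rV[R]_n -> E :=
  bipyr_chart (out_facet a) (lower_vec last) (lower_vec z).

Definition is_in_chart a (phi : 'rV[R]_n -> E) : Prop :=
  exists i j : 'I_n, i != j /\ phi = in_chart a (a \o tperm i j).

Definition is_out_chart a (phi : 'rV[R]_n -> E) : Prop :=
  exists (k : 'I_n) (z : A),
    [/\ k.+1 = n, opposite_entry f a z & phi = out_chart a (a k) z].

Definition atlas : set ('rV[R]_n -> E) :=
  [set phi | exists2 a, NCT f a & is_in_chart a phi \/ is_out_chart a phi].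

(* The tangent vector X at x is identified with v in R^V: v is the image of X
   under the differential of the inclusion of OSer in R^V. *)
Definition ambient (x : E) (X : @tvec R n E) (v : E) : Prop :=
  forall phi u, atlas phi -> Bipyr u -> phi u = x ->
  forall w : vertex f, is_derive u (X phi) (fun t => phi t w : R) (v w).

Definition standard_metric (g : E -> @tvec R n E -> @tvec R n E -> R) : Prop :=
  [/\ forall x, OSer x -> bilinear_at Bipyr atlas g x,
      forall a x, NCT f a ->
        OCvx (range (lower_vec \o a) `|` [set upper_vec (f a)]) x ->
        forall i j X Y, tangent Bipyr atlas x X -> tangent Bipyr atlas x Y ->
        ambient x X (lower_vec (a i) - upper_vec (f a)) ->
        ambient x Y (lower_vec (a j) - upper_vec (f a)) ->
        g x X Y = 1 + (i == j)%:R,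
      (* The last coordinate direction is that of the output f(a). *)
      forall a phi u, NCT f a -> is_out_chart a phi -> Bipyr u ->
        OCvx (range (out_facet a)) (phi u) ->
        forall i j, gram Bipyr atlas g phi u i j = 1 + (i == j)%:R
    & forall a phi u, NCT f a -> is_in_chart a phi -> Bipyr u ->
        OCvx (range (lower_vec \o a)) (phi u) ->
        forall i j, gram Bipyr atlas g phi u i j = 1 + (i == j)%:R].

End Serenation.

Arguments basis_vec R {n A f} v.
Arguments lower_vec R {n A} f x.
Arguments upper_vec R {n A} f x.
Arguments OSer R {n A} f.
Arguments Bipyr R n : clear implicits.
Arguments bipyr_chart {R n A f} e p q u.
Arguments in_chart R {n A} f a a'.
Arguments out_facet R {n A} f a i.
Arguments out_chart R {n A} f a last z.
Arguments is_in_chart R {n A} f a phi.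
Arguments is_out_chart R {n A} f a phi.
Arguments atlas R {n A} f.
Arguments ambient {R n A} f x X v.
Arguments standard_metric {R n A} f g.

(* Main.v *)
Require Import Defs.
From HB Require Import structures.
From mathcomp Require Import all_boot all_order all_algebra all_fingroup.
From mathcomp Require Import all_classical all_reals all_analysis.
From mathcomp Require Import ring lra.

Set Implicit Arguments.
Unset Strict Implicit.
Unset Printing Implicit Defensive.

Import Order.TTheory GRing.Theory Num.Theory.
Import numFieldNormedType.Exports.

Local Open Scope classical_set_scope.
Local Open Scope ring_scope.

(** Two facts about the complex carry the theorem.  The facet with vertices
    [a_1, .., a_n] lies in exactly two top simplices, because an alternating [f]
    takes exactly two values on the orderings of a non-commuting tuple; the
    facet with vertices [a_1, .., a_(n-1), f(a)] lies in exactly two, because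
    each way of inserting the missing entry (up to even permutations there are
    two) has a unique solution.  So around each point the open serenation looks
    like two open simplices with vertices [e_1, .., e_n, p] and
    [e_1, .., e_n, q], glued along the open facet of the [e_i]: a [hinge]
    ([face_hinge], [in_hinge], [out_hinge], [OSer_cover]).

    A chart unfolds a hinge onto the bipyramid.  With [m] equal to [|u| - 1]
    above the equator [|u| = 1] and to [0] below, it sends [u] to
    [p + sum_i u_i (e_i - p) + m (p + q - 2/n sum_i e_i)], and its inverse is
    the restriction to the serenation of the linear map
    [x |-> (x(e_i) + 2/n x(q))_i] of [R^V].  A change of charts is therefore
    affine on each side of the equator.  It does not bend at the equator either:
    a point of the equator lies in the open facet of both hinges, so the hinges
    have the same facet and the same two opposite vertices, and the inverse
    chart kills [p + q - 2/n sum_i e_i] ([equator_jac], [overlap_affine]).  Thus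
    changes of charts are locally affine.

    Below the equator the coordinate vectors of a chart are [e_i - p], above it
    they are [e_i + q - 2/n sum_j e_j].  In the Euclidean product of [R^V] both
    families have the Gram matrix [1 + delta_ij] ([slope_dir]): unfolding puts
    the upper simplex in the place of the mirror image of the lower one.  Hence
    the Jacobian matrices of the changes of charts preserve the scalar product with
    matrix [1 + delta_ij] ([gdot_jac]).  At each point one of the three rules of
    the standard metric says that some chart has this Gram matrix, so every
    chart has it everywhere ([gram_const]); the metric is constant in
    coordinates and the Christoffel symbols vanish ([hinged_flat]).  Conversely,
    the scalar product with this matrix in an arbitrarily chosen chart around
    each point is a standard metric ([chart_metric]).

    There remain the topological requirements.  A chart meets only charts whose
    facets have their vertices among [n + 2] given ones, so a component is
    covered by countably many charts and has all its points supported in a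
    countable set of vertices ([hinged_second_countable]). *)

(** * Pointwise topology *)

Lemma cvg_initial (S : choiceType) (T : topologicalType) (h : S -> T)
    (F : set_system S) (x : S) : Filter F ->
  h @ F --> h x -> F --> (x : initial_topology h).
Proof.
move=> FF hF A; rewrite nbhsE => -[B [[C oC <-] Cx] BA].
by apply: filterS BA _; apply: hF; apply: open_nbhs_nbhs.
Qed.

Section PointwiseSpace.
Context {R : realType} {V : Type}.
Local Notation E := (pw_space R V).

Lemma eval_continuous (w : V) : continuous (fun x : E => x w : R).
Proof.
move=> x; have /cvg_sup/(_ w) c : x --> (x : {ptws V -> R}) by exact: cvg_id.
have e := @initial_continuous _ _ (fun y : {ptws V -> R} => y w) x.
by move=> A /e /c.
Qed.

Lemma pw_cvg (F : set_system E) (x : E) : Filter F ->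
  (forall w, (fun y : E => y w : R) @ F --> (x w : R)) -> F --> x.
Proof. by move=> FF h; apply/cvg_sup => w; apply: cvg_initial; exact: h. Qed.

Lemma pw_continuous (T : topologicalType) (h : T -> E) :
  (forall w, continuous (fun t => h t w : R)) -> continuous h.
Proof. by move=> hc t; apply: pw_cvg => w; exact: hc. Qed.

Lemma open_eval_pos (w : V) : open [set y : E | 0 < (y w : R)].
Proof.
apply: (@open_comp _ _ (fun y : E => y w : R) [set r : R | 0 < r]).
  by move=> y _; exact: eval_continuous.
exact: open_gt.
Qed.

Lemma pw_subspace_hausdorff (M : set E) : hausdorff_space (set_type M).
Proof.
rewrite open_hausdorff => x y xy.
have [w xyw] : exists w, (\val x : E) w != (\val y : E) w.
  apply: contrapT => /forallNP h; case/eqP: xy; apply/val_inj/funext => w.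
  by apply/eqP; apply: contrapT => /negP; exact: h.
have := @Rhausdorff R; rewrite open_hausdorff.
move=> /(_ _ _ xyw)[[A B] /= [xA yB] [oA oB AB]].
pose ev (z : set_type M) : R := (\val z : E) w.
have evc : continuous ev.
  move=> z; apply: (@continuous_comp _ _ _ (set_val : set_type M -> E)
    (fun y : E => y w : R)); last exact: eval_continuous.
  exact: initial_continuous.
exists (ev @^-1` A, ev @^-1` B) => /=; first by rewrite !inE in xA yB *.
split; [by apply: open_comp => // ? _; exact: evc.. | ].
apply/eqP/seteqP; split=> z // [zA zB].
by have : (A `&` B) (ev z) by []; rewrite (eqP AB).
Qed.

End PointwiseSpace.

(** A neighbourhood of a point constrains finitely many coordinates only, so
    rational bounds on finitely many coordinates in [S] give a countable
    basis. *)
Lemma pw_second_countable (R : realType) (V : Type) (S : set V)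
    (X : set (pw_space R V)) :
  countable S -> (forall y w, X y -> ~ S w -> y w = 0) ->
  @second_countable (set_type X).
Proof.
move=> /countable_injP[num numI] X0.
pose box (l : seq (nat * rat * rat)) : set (set_type X) := [set y |
  forall t w, t \in l -> S w -> num w = t.1.1 ->
    ratr t.1.2 < (set_val y : pw_space R V) w < ratr t.2].
have evc w : continuous (fun y : set_type X => (set_val y : pw_space R V) w : R).
  move=> z; apply: (@continuous_comp _ _ _ (set_val : set_type X -> pw_space R V)
    (fun y : pw_space R V => y w : R)); last exact: eval_continuous.
  exact: initial_continuous.
have box_open l : open (box l).
  elim: l => [|t l IH].
    rewrite (_ : box _ = setT); first exact: openT.
    by apply/seteqP; split=> // y _ t w.
  pose one := [set y : set_type X | forall w, S w -> num w = t.1.1 ->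
    ratr t.1.2 < (set_val y : pw_space R V) w < ratr t.2].
  have -> : box (t :: l) = one `&` box l.
    apply/seteqP; split=> y /=.
      move=> h; split=> [w Sw e|t' w t'l Sw e]; apply: h => //.
        exact: mem_head.
      by rewrite inE t'l orbT.
    by move=> [h1 h2] t' w; rewrite inE => /predU1P[->|]; [exact: h1|exact: h2].
  apply: openI => //.
  case: (pselect (exists2 w, S w & num w = t.1.1)) => [[w Sw e]|no]; last first.
    rewrite (_ : one = setT); first exact: openT.
    by apply/seteqP; split=> // y _ w Sw e; case: no; exists w.
  have -> : one = (fun y : set_type X => (set_val y : pw_space R V) w : R) @^-1`
      `]ratr t.1.2, ratr t.2[%classic.
    apply/seteqP; split=> y /=; rewrite in_itv /=; first exact.
    move=> h w' Sw' e'; rewrite (_ : w' = w)//.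
    by apply: numI; rewrite ?inE// e'.
  by apply: open_comp; [move=> ? _; exact: evc|exact: itv_open].
exists (range box); first exact: sub_countable (card_image_le _ _) (countableP _).
split=> [_ [l _ <-]//|x].
have FF : Filter (filter_from [set U | range box U /\ U x] id).
  apply: filter_from_filter; first by exists (box [::]); split=> //; exists [::].
  move=> _ _ [[l1 _ <-] x1] [[l2 _ <-] x2]; exists (box (l1 ++ l2)).
    split; first by exists (l1 ++ l2).
    by move=> t w; rewrite mem_cat => /orP[]; [exact: x1|exact: x2].
  by move=> y h; split=> t w tl; apply: h; rewrite mem_cat tl ?orbT.
apply: cvg_initial; apply: pw_cvg => w.
case: (pselect (S w)) => [Sw|nSw]; last first.
  have z (y : set_type X) : (set_val y : pw_space R V) w = 0.
    by apply: X0 => //; exact: set_valP.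
  move=> A /nbhs_singleton; rewrite z => A0.
  exists (box [::]); first by split=> //; exists [::].
  by move=> y _; rewrite /= z.
move=> A /nbhs_ballP[e /= e0 eA].
have lt1 : (set_val x : pw_space R V) w - e < (set_val x : pw_space R V) w by lra.
have lt2 : (set_val x : pw_space R V) w < (set_val x : pw_space R V) w + e by lra.

have [q] := rat_in_itvoo lt1; rewrite in_itv /= => /andP[q1 q2].
have [r] := rat_in_itvoo lt2; rewrite in_itv /= => /andP[r1 r2].
exists (box [:: (num w, q, r)]).
  split; first by exists [:: (num w, q, r)].
  move=> t w'; rewrite inE => /eqP -> /= Sw' e'.
  by rewrite (_ : w' = w) ?q2//; apply: numI; rewrite ?inE.
move=> y /(_ _ w (mem_head _ _) Sw erefl) /andP[/= h1 h2].
apply: eA; rewrite /ball /= ltr_norml; apply/andP; split; lra.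
Qed.

(** Chains of members of the cover that start at a given one and in which
    consecutive members meet reach countably many members; their union is
    relatively clopen, since the members that are not reached are disjoint
    from it. *)
Lemma component_countable_cover (T : topologicalType) (M : set T) (I : Type)
    (J : set I) (O : I -> set T) (x : T) :
  M x -> (forall i, J i -> open (O i)) -> M `<=` \bigcup_(i in J) O i ->
  (forall i, J i ->
     countable [set j | J j /\ exists2 y, M y & O i y /\ O j y]) ->
  exists2 K, countable K /\ K `<=` J &
    connected_component M x `<=` \bigcup_(i in K) O i.
Proof.
move=> Mx oO cover loc; have [i0 Ji0 Oi0] := cover x Mx.
pose near i := [set j | J j /\ exists2 y, M y & O i y /\ O j y].
pose reach := fix reach m := if m is m'.+1
  then \bigcup_(i in reach m') near i else [set i0].
have reachJ m : reach m `<=` J by case: m => [_ ->//|m i /= [j _ []]].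
have reachC m : countable (reach m).
  elim: m => [|m IH] /=; first exact: countable1.
  by apply: bigcup_countable => // i /reachJ; exact: loc.
pose K := \bigcup_m reach m.
have KJ : K `<=` J by move=> i [m _ /reachJ].
exists K.
  by split=> //; apply: bigcup_countable.
have near_in i j y : K i -> J j -> M y -> O i y -> O j y -> K j.
  move=> [m _ mi] Jj My Oi Oj; exists m.+1 => //; exists i => //.
  by split=> //; exists y.
pose U := \bigcup_(i in K) O i; pose U' := \bigcup_(i in J `\` K) O i.
have CM := @connected_component_sub _ M x.
have e : connected_component M x `&` U = connected_component M x.
  apply: (@component_connected _ M x).
  - exists x; split; first exact: connected_component_refl.
    by exists i0 => //; exists 0%N.
  - by exists U => //; apply: bigcup_open => i /KJ /oO.
  - exists (~` U').
      by apply: open_closedC; apply: bigcup_open => i [/oO].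
    apply/seteqP; split=> y [Cy].
      move=> [i Ki Oi]; split=> // -[j [Jj nKj] Oj]; apply: nKj.
      exact: (near_in i j y Ki Jj (CM _ Cy)).
    move=> nU'; split=> //; have [i Ji Oi] := cover y (CM _ Cy).
    exists i => //; apply: contrapT => nK; apply: nU'; by exists i.
by rewrite -e => y [].
Qed.

(** * Locally affine maps *)

Section LocallyAffine.
Context {R : realType} {n : nat}.
Implicit Types (u w : 'rV[R]_n) (W : set 'rV[R]_n).

Lemma mx_continuous (T : topologicalType) (m k : nat) (F : T -> 'M[R]_(m, k)) :
  (forall i j, continuous (fun t => F t i j)) -> continuous F.
Proof.
move=> Fc t B [P /= Pn PB]; apply: filterS (_ : \forall z \near t,
  forall i j, P i j (F z i j)) => [z Pz|]; first exact: PB.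
by apply: filter_forall => i; apply: filter_forall => j; apply: Fc.
Qed.

Lemma sum_continuous (T : topologicalType) (m : nat) (F : 'I_m -> T -> R) :
  (forall i, continuous (F i)) -> continuous (fun t => \sum_i F i t).
Proof. by move=> Fc t; apply: cvg_big => [|i _]; [exact: add_continuous|exact: Fc]. Qed.

Lemma mulmxr_continuous (m : nat) (A : 'M[R]_(n, m)) :
  continuous (mulmxr A : 'rV[R]_n -> 'rV[R]_m).
Proof.
apply: mx_continuous => i j M.
rewrite (_ : (fun t => mulmxr A t i j) = fun M : 'rV[R]_n => \sum_k M i k * A k j).
  apply: sum_continuous => k t.
  apply: (@continuousM R _ (fun M : 'rV[R]_n => M i k) (cst (A k j))).
    exact: coord_continuous.
  exact: cst_continuous.
by apply/funext => N; rewrite /= mxE.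
Qed.

Lemma near_linear_diff (X Y : normedModType R) (h : X -> Y)
    (L : {linear X -> Y}) (x : X) :
  continuous L -> (\forall y \near x, h y = h x + L (y - x)) ->
  differentiable h x /\ 'd h x = L :> (X -> Y).
Proof.
move=> Lc hL.
have e : h \o shift x = cst (h x) + L +o_ 0 id.
  apply/eqaddoP => _/posnumP[e].
  have : \forall t \near (0 : X), h (t + x) = h x + L t.
    rewrite (near_shift x) sub0r; near=> y => /=.
    by rewrite subrK; near: y.
  apply: filterS => t /= ht.
  by rewrite !fctE /= ht subrr normr0 mulr_ge0.
have dE := diff_unique Lc e; split=> //.
by apply/diff_locallyP; rewrite dE.
Unshelve. all: by end_near. Qed.

Lemma near_affine_jacobian (m : nat) (h : 'rV[R]_n -> 'rV[R]_m) u
    (A : 'M[R]_(n, m)) :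
  (\forall w \near u, h w = h u + (w - u) *m A) -> 'J h u = A.
Proof.
move=> hA; have [_ dE] := near_linear_diff (L := mulmxr A) (@mulmxr_continuous _ A) hA.
apply/row_matrixP => i; rewrite !rowE mul_rV_lin1 dE.
by [].
Qed.

Lemma near_affine_continuous (m : nat) (h : 'rV[R]_n -> 'rV[R]_m) u
    (A : 'M[R]_(n, m)) :
  (\forall w \near u, h w = h u + (w - u) *m A) -> {for u, continuous h}.
Proof.
move=> hA; have [d _] := near_linear_diff (L := mulmxr A) (@mulmxr_continuous _ A) hA.
exact: differentiable_continuous d.
Qed.

Definition locally_affine W (h : 'rV[R]_n -> R) := forall u, W u ->
  exists c : 'cV[R]_n, \forall w \near u, h w = h u + ((w - u) *m c) 0 0.

Lemma near_affine_differentiable (h : 'rV[R]_n -> R) u (c : 'cV[R]_n) :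
  (\forall w \near u, h w = h u + ((w - u) *m c) 0 0) ->
  differentiable h u /\ forall v, 'D_v h u = (v *m c) 0 0.
Proof.
move=> hc.
have lin : linear (fun w : 'rV[R]_n => (w *m c) 0 0).
  by move=> k x y; rewrite mulmxDl -scalemxAl !mxE.
pose L : {linear 'rV[R]_n -> R} := HB.pack (fun w : 'rV[R]_n => (w *m c) 0 0)
  (GRing.isLinear.Build _ _ _ _ _ lin).
have Lc : continuous L.
  move=> w; apply: (@continuous_comp _ _ _ (mulmxr c) (fun M : 'rV[R]_1 => M 0 0)).
    exact: (@mulmxr_continuous _ c).
  exact: coord_continuous.
have [d dE] := near_linear_diff Lc hc.
by split=> // v; rewrite deriveE// dE.
Qed.


(** The partial derivatives of a locally affine function are locally constant. *)
Lemma locally_affine_partial W (h : 'rV[R]_n -> R) (i : 'I_n) :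
  locally_affine W h -> locally_affine W (partial i h).
Proof.
move=> hW u /hW[c hc]; exists 0.
have h' : \forall w \near u, partial i h w = c i 0.
  apply: filterS (near_join hc) => w hw.
  have hw' : \forall z \near w, h z = h w + ((z - w) *m c) 0 0.
    have ew := nbhs_singleton hw.
    apply: filterS hw => z ->; rewrite ew -addrA; congr (_ + _).
    have -> : z - u = (w - u) + (z - w) by rewrite [RHS]addrC subrKA.
    by rewrite mulmxDl [LHS]mxE.
  have [_ dE] := near_affine_differentiable hw'; rewrite /partial dE.
  by rewrite -rowE mxE.
have e0 := nbhs_singleton h'; apply: filterS h' => w ->.
by rewrite mulmx0 mxE addr0 e0.
Qed.

Lemma smooth_locally_affine W (h : 'rV[R]_n -> R) :
  locally_affine W h -> smooth_on W h.
Proof.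
move=> hW s; have : locally_affine W (foldr partial h s).
  by elim: s => //= i s IH; exact: locally_affine_partial.
by move=> hs u /hs[c /near_affine_differentiable[]].
Qed.

End LocallyAffine.

(** * Open convex hulls of finite sets of basis vectors *)

Section OpenSimplex.
Context {R : realType} {V : Type}.
Local Notation E := (pw_space R V).
Implicit Types (x y : E) (w : V).

Definition delta (v : V) : E := fun w => (`[< w = v >])%:R.

Lemma deltaE v w : delta v w = (`[< w = v >])%:R :> R.
Proof. by []. Qed.

Lemma delta_same v : delta v v = 1 :> R.
Proof. by rewrite deltaE asboolT. Qed.

Lemma delta_neq v w : w <> v -> delta v w = 0 :> R.
Proof. by move=> wv; rewrite deltaE asboolF. Qed.

Lemma eval_comb (m : nat) (c : 'I_m -> R) (z : 'I_m -> E) w :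
  (\sum_i c i *: z i) w = \sum_i c i * (z i w : R) :> R.
Proof. by rewrite fct_sumE. Qed.

Lemma sum_delta_inj (m : nat) (t : 'I_m -> V) (c : 'I_m -> R) k :
  injective t -> \sum_i c i * delta (t i) (t k) = c k.
Proof.
move=> tI; rewrite (bigD1 k)//= delta_same mulr1 big1 ?addr0// => i ik.
by rewrite delta_neq ?mulr0// => /tI ki; rewrite ki eqxx in ik.
Qed.

Lemma sum_delta_out (m : nat) (t : 'I_m -> V) (c : 'I_m -> R) w :
  ~ range t w -> \sum_i c i * delta (t i) w = 0.
Proof.
move=> tw; rewrite big1// => i _.
by rewrite delta_neq ?mulr0// => wi; apply: tw; exists i.
Qed.

Lemma sum_range_delta (m : nat) (t : 'I_m -> V) v :
  injective t -> range t v -> \sum_i delta v (t i) = 1 :> R.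
Proof.
move=> tI [k _ <-]; rewrite (bigD1 k)//= delta_same big1 ?addr0// => i ik.
by rewrite delta_neq// => /tI ki; rewrite ki eqxx in ik.
Qed.

Lemma comb_delta (m : nat) (t : 'I_m -> V) x :
  injective t -> (forall w, ~ range t w -> x w = 0) ->
  x = \sum_i (x (t i) : R) *: delta (t i).
Proof.
move=> tI x0; apply/funext => w; rewrite eval_comb.
case: (pselect (range t w)) => [[k _ <-]|tw]; first by rewrite sum_delta_inj.
by rewrite x0// sum_delta_out.
Qed.

Definition on_simplex (m : nat) (t : 'I_m -> V) : set E :=
  [set x | (forall w, ~ range t w -> x w = 0) /\ \sum_i (x (t i) : R) = 1].

Lemma comb_on_simplex (m k : nat) (t : 'I_m -> V) (p : 'I_k -> E)
    (c : 'I_k -> R) : injective t ->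
  (forall i, (delta @` range t) (p i)) -> \sum_i c i = 1 ->
  on_simplex t (\sum_i c i *: p i).
Proof.
move=> tI pt c1; split=> [w tw|].
  rewrite eval_comb big1// => i _; have [v tv <-] := pt i.
  by rewrite delta_neq ?mulr0// => wv; apply: tw; rewrite wv.
under eq_bigr do rewrite eval_comb.
rewrite exchange_big -[RHS]c1 /=; apply: eq_bigr => i _.
have [v tv <-] := pt i.
by rewrite -mulr_sumr sum_range_delta ?mulr1.
Qed.

Lemma affine_hull_simplex (m : nat) (t : 'I_m -> V) : injective t ->
  affine_hull (delta @` range t) = on_simplex t.
Proof.
move=> tI; apply/seteqP; split=> x.
  by move=> [k [p [c [pt c1 ->]]]]; exact: comb_on_simplex.
move=> [x0 x1]; exists m, (delta \o t), (x \o t); split=> //=.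
  by move=> i; exists (t i) => //; exists i.
exact: comb_delta.
Qed.

Lemma convex_hull_simplex (m : nat) (t : 'I_m -> V) : injective t ->
  convex_hull (delta @` range t) =
  on_simplex t `&` [set x | forall i, 0 <= (x (t i) : R)].
Proof.
move=> tI; apply/seteqP; split=> x.
  move=> [k [p [c [pt c0 c1 ->]]]]; split; first exact: comb_on_simplex.
  move=> i; rewrite eval_comb sumr_ge0// => j _; rewrite mulr_ge0//.
  by have [v _ <-] := pt j; rewrite deltaE.
move=> [[x0 x1] xp]; exists m, (delta \o t), (x \o t); split=> //=.
  by move=> i; exists (t i) => //; exists i.
exact: comb_delta.
Qed.

(** A point of the relative interior can be pushed away from the barycentre
    without leaving the simplex, so all its coordinates are positive. *)
Lemma OCvx_simplex (m : nat) (t : 'I_m -> V) : injective t ->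
  OCvx (delta @` range t) =
  on_simplex t `&` [set x | forall i, 0 < (x (t i) : R)].
Proof.
move=> tI; apply/seteqP; split=> x; rewrite /OCvx /= affine_hull_simplex//.
  rewrite convex_hull_simplex// => -[xt nx]; split=> // i.
  have m0 : (m%:R : R) != 0 by rewrite pnatr_eq0 -lt0n (leq_ltn_trans _ (ltn_ord i)).
  pose b : E := \sum_j (m%:R^-1 : R) *: delta (t j).
  have [b0 b1] : on_simplex t b.
    apply: comb_on_simplex => // [j|]; first by exists (t j) => //; exists j.
    by rewrite sumr_const card_ord -[LHS]mulr_natr mulVf.
  pose y (s : R) : E := (fun w => x w + s * (x w - b w)) : E.
  have yt s : on_simplex t (y s).
    case: xt => x0 x1; split=> [w tw|]; first by rewrite /y x0// b0// subrr mulr0 addr0.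
    by rewrite big_split/= -mulr_sumr sumrB x1 b1 subrr mulr0 addr0.
  have y0 : y 0 = x by apply/funext => w; rewrite /y mul0r addr0.
  have yc : y @ 0 --> (x : E).
    rewrite -y0; apply: pw_continuous => w s; rewrite /y.
    apply: cvgD; first exact: cvg_cst.
    by apply: cvgM; [exact: cvg_id|exact: cvg_cst].
  have /nbhs_ballP[e /= e0 eh] := yc _ nx.
  have [|_ /(_ i)] := eh (e / 2) _ (yt (e / 2)).
    by rewrite /ball /= sub0r normrN gtr0_norm ?divr_gt0// ltr_pdivrMr// ltr_pMr// ltr1n.
  have bi : b (t i) = m%:R^-1 by rewrite /b eval_comb sum_delta_inj.
  rewrite /y bi => h.
  have mi : 0 < (m%:R^-1 : R) by rewrite invr_gt0 lt_def m0 ler0n.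
  have : 0 < e / 2 * m%:R^-1 by rewrite mulr_gt0// divr_gt0.
  have e2 : 0 < e / 2 by rewrite divr_gt0.
  move: h; set s := e / 2 in e2 *; set z := (x (t i) : R).
  by case: (ltP 0 z) => // z0; nra.
rewrite convex_hull_simplex// => -[xt xp]; split=> //.
have : \forall y \near (x : E), forall i, 0 < (y (t i) : R).
  apply: (@filter_forall E 'I_m (fun i (y : E) => 0 < (y (t i) : R)) (nbhs (x : E))).
  by move=> i; apply: open_nbhs_nbhs; split; [exact: open_eval_pos|exact: xp].
by apply: filterS => y yp yt; split=> // i; exact: ltW.
Qed.

End OpenSimplex.

(** * The open bipyramid *)

Section Bipyramid.
Context {R : realType} {n : nat}.
Hypothesis n_gt0 : (0 < n)%N.
Implicit Types u w : 'rV[R]_n.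

Let n0 : (n%:R : R) != 0.
Proof. by rewrite pnatr_eq0 -lt0n. Qed.

Let ni0 : 0 < (n%:R^-1 : R).
Proof. by rewrite invr_gt0 ltr0n. Qed.

(** Above the equator [|u| = 1] this is the weight of the upper apex in a chart
    of the serenation, below it vanishes. *)
Definition height u : R := Num.max 0 (coord_sum u - 1).

Lemma height_low u : coord_sum u <= 1 -> height u = 0.
Proof. by move=> u1; rewrite /height max_l// subr_le0. Qed.

Lemma height_high u : 1 <= coord_sum u -> height u = coord_sum u - 1.
Proof. by move=> u1; rewrite /height max_r// subr_ge0. Qed.

Lemma height_ge0 u : 0 <= height u.
Proof. by rewrite /height le_max lexx. Qed.

Lemma height_bounds u (r : R) :
  (2 / n%:R * height u <= r) = (0 <= r) && (2 / n%:R * (coord_sum u - 1) <= r).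
Proof. by rewrite /height maxr_pMr ?divr_ge0// mulr0 ge_max. Qed.

Lemma height_bounds_lt u (r : R) :
  (2 / n%:R * height u < r) = (0 < r) && (2 / n%:R * (coord_sum u - 1) < r).
Proof. by rewrite /height maxr_pMr ?divr_ge0// mulr0 gt_max. Qed.

Lemma coord_sum_continuous : continuous (@coord_sum R n).
Proof. by apply: sum_continuous => i; exact: coord_continuous. Qed.

Lemma coord_sum0 : coord_sum (0 : 'rV[R]_n) = 0.
Proof. by rewrite /coord_sum big1// => i _; rewrite mxE. Qed.

Lemma coord_sumD u w : coord_sum (u + w) = coord_sum u + coord_sum w.
Proof. by rewrite /coord_sum -big_split; apply: eq_bigr => i _; rewrite mxE. Qed.

Lemma coord_sumZ (c : R) u : coord_sum (c *: u) = c * coord_sum u.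
Proof. by rewrite /coord_sum mulr_sumr; apply: eq_bigr => i _; rewrite mxE. Qed.

Lemma coord_sumN u : coord_sum (- u) = - coord_sum u.
Proof. by rewrite -scaleN1r coord_sumZ mulN1r. Qed.

Lemma coord_sum_delta (i : 'I_n) : coord_sum (delta_mx 0 i : 'rV[R]_n) = 1.
Proof.
rewrite /coord_sum (bigD1 i)//= mxE !eqxx big1 ?addr0// => j ji.
by rewrite mxE (negPf ji).
Qed.

Lemma coord_sum_const (c : R) : coord_sum (const_mx c : 'rV[R]_n) = n%:R * c.
Proof.
rewrite /coord_sum; under eq_bigr do rewrite mxE.
by rewrite sumr_const card_ord mulr_natl.
Qed.

Lemma coord_sum_apex : coord_sum (const_mx (2 / n%:R) : 'rV[R]_n) = 2.
Proof. by rewrite coord_sum_const mulrC divfK. Qed.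

Lemma coord_sum_comb (m : nat) (c : 'I_m -> R) (p : 'I_m -> 'rV[R]_n) :
  coord_sum (\sum_k c k *: p k) = \sum_k c k * coord_sum (p k).
Proof.
elim/big_ind2: _ => [|x a y b <- <-|k _]; last exact: coord_sumZ.
  exact: coord_sum0.
exact: coord_sumD.
Qed.

Definition bipyr_vertices : set 'rV[R]_n :=
  [set 0; const_mx (2 / n%:R)] `|` range (fun i : 'I_n => delta_mx 0 i).

(** A point of the closed bipyramid is seen to be in the convex hull by taking
    for [q] the apex on its side of the equator and for [c] the weight that
    makes the weights sum to 1. *)
Lemma apex_comb (q : 'rV[R]_n) (c : R) u : bipyr_vertices q ->
  exists (p : 'I_n.+1 -> 'rV[R]_n) (d : 'I_n.+1 -> R),
    [/\ forall k, bipyr_vertices (p k), \sum_k d k = coord_sum u - c * coord_sum q + c,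
      u = \sum_k d k *: p k
      & 0 <= c -> (forall i, c * q 0 i <= u 0 i) -> forall k, 0 <= d k].
Proof.
move=> Xq; pose v := u - c *: q.
exists (fun k => if unlift ord0 k is Some i then delta_mx 0 i else q).
exists (fun k => if unlift ord0 k is Some i then v 0 i else c).
split.
- by move=> k; case: unliftP => [i _|_]//; right; exists i.
- rewrite big_ord_recl unlift_none addrC; congr (_ + _).
  under eq_bigr do rewrite liftK.
  by rewrite -[LHS]/(coord_sum v) coord_sumD coord_sumN coord_sumZ.
- rewrite big_ord_recl unlift_none.
  under eq_bigr do rewrite liftK.
  by rewrite -row_sum_delta addrC subrK.
- move=> c0 cu k; case: unliftP => [i _|_]//.
  by rewrite !mxE subr_ge0.
Qed.

Lemma Bipyr_affine_hull u :
  affine_hull (bipyr_vertices : set ('rV[R]_n : normedModType R)) u.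
Proof.
have [p [d [pX d1 uE _]]] := apex_comb (1 - coord_sum u) u (or_introl (or_introl erefl)).
exists n.+1, p, d; split=> //; rewrite d1 coord_sum0; ring.
Qed.

Lemma Bipyr_convex_hull :
  convex_hull (bipyr_vertices : set ('rV[R]_n : normedModType R)) =
  [set u | forall i, 2 / n%:R * height u <= u 0 i].
Proof.
apply/seteqP; split=> u.
  move=> [m [p [c [pX c0 c1 uE]]]] i; rewrite height_bounds//.
  have uiE : u 0 i = \sum_k c k * p k 0 i.
    by rewrite uE summxE; apply: eq_bigr => k _; rewrite mxE.
  rewrite -[X in _ && X]subr_ge0 -[X in _ * (_ - X)]c1 uE coord_sum_comb -uE uiE.
  rewrite -sumrB mulr_sumr -sumrB; apply/andP; split; apply: sumr_ge0 => k _.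
    rewrite mulr_ge0//; have [[->|->]|[j _ <-]] := pX k;
      by rewrite mxE ?divr_ge0 ?ler0n.
  rewrite -[X in _ - _ * (_ - X)](mulr1 (c k)) -mulrBr mulrCA -mulrBr mulr_ge0//.
  have [[->|->]|[j _ <-]] := pX k.
  - rewrite coord_sum0 mxE !sub0r mulrN opprK mulr1.
    by rewrite divr_ge0.
  - by rewrite coord_sum_apex mxE (_ : _ - _ = 0)//; ring.
  - by rewrite coord_sum_delta subrr mulr0 subr0 mxE.
move=> /= uh; have [u1|/ltW u1] := leP (coord_sum u) 1.
  have [p [d [pX d1 uE dp]]] := apex_comb (1 - coord_sum u) u (or_introl (or_introl erefl)).
  exists n.+1, p, d; split=> //; last first.
    by rewrite d1 coord_sum0; ring.
  apply: dp => [|i]; first by rewrite subr_ge0.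
  by have := uh i; rewrite height_low// mxE !mulr0.
have [p [d [pX d1 uE dp]]] := apex_comb (coord_sum u - 1) u (or_introl (or_intror erefl)).
exists n.+1, p, d; split=> //.
  apply: dp => [|i]; first by rewrite subr_ge0.
  by have := uh i; rewrite height_high// mxE mulrC.
by rewrite d1 coord_sum_apex; ring.
Qed.

Lemma open_above : open [set u : 'rV[R]_n | forall i, 2 / n%:R * height u < u 0 i].
Proof.
rewrite openE => u uh; rewrite /interior.
apply: (@filter_forall 'rV[R]_n 'I_n (fun i w => 2 / n%:R * height w < w 0 i) (nbhs u)).
move=> i; have := uh i; rewrite height_bounds_lt => /andP[u1 u2].
have c1 : \forall w \near u, 0 < (w : 'rV[R]_n) 0 i.
  apply: (@coord_continuous R 1 n 0 i u [set r | 0 < r]).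
  exact: (open_nbhs_nbhs (conj (@open_gt _ 0) u1)).
have c2 : \forall w \near u, 0 < (w : 'rV[R]_n) 0 i - 2 / n%:R * (coord_sum w - 1).
  pose F := fun w : 'rV[R]_n => w 0 i - 2 / n%:R * (coord_sum w - 1).
  have Fc : {for u, continuous F}.
    apply: (@continuousB _ _ _ (fun w : 'rV[R]_n => w 0 i)
      (fun w => 2 / n%:R * (coord_sum w - 1))); first exact: coord_continuous.
    apply: (@continuousM _ _ (cst (2 / n%:R)) (fun w : 'rV[R]_n => coord_sum w - 1)).
      exact: cst_continuous.
    apply: (@continuousB _ _ _ (@coord_sum R n) (cst 1)).
      exact: coord_sum_continuous.
    exact: cst_continuous.
  apply: (Fc [set r | 0 < r]); apply: open_nbhs_nbhs; split; first exact: open_gt.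
  by rewrite /F /= subr_gt0.
apply: filterS2 c1 c2 => w w1 w2.
by rewrite height_bounds_lt w1 /= -subr_gt0.
Qed.

(** As for simplices, an interior point can be pushed away from a centre, here
    the barycentre of the equator, without leaving the convex hull. *)
Lemma BipyrE :
  Bipyr R n = [set u : 'rV[R]_n | forall i, 2 / n%:R * height u < u 0 i].
Proof.
apply/seteqP; split=> u; last first.
  move=> uh; split; first exact: Bipyr_affine_hull.
  rewrite -/bipyr_vertices Bipyr_convex_hull.
  apply: filterS (open_nbhs_nbhs (conj open_above uh)).
  by move=> w wh _ i; apply: ltW.
move=> [_]; rewrite -/bipyr_vertices Bipyr_convex_hull => nu i.
pose b : 'rV[R]_n := const_mx n%:R^-1.
pose y (s : R) := u + s *: (u - b).
have y0 : y 0 = u by rewrite /y scale0r addr0.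
have yc : y @ 0 --> u.
  rewrite -[X in _ --> X]y0; apply: mx_continuous => k j s.
  rewrite (_ : (fun t => y t k j) = (fun t => u k j + t * (u - b) k j)).
    apply: cvgD; first exact: cvg_cst.
    by apply: cvgM; [exact: cvg_id|exact: cvg_cst].
  by apply/funext => t; rewrite !mxE.
have /nbhs_ballP[e /= e0 eh] := yc _ nu.
have e2 : 0 < e / 2 by rewrite divr_gt0.
have := eh (e / 2) _ (Bipyr_affine_hull _) i.
rewrite height_bounds// /y coord_sumD coord_sumZ coord_sumD coord_sumN coord_sum_const.
rewrite mulfV// !mxE => h.
have /andP[h1 h2] : (0 <= u 0 i + e / 2 * (u 0 i - n%:R^-1)) &&
  (2 / n%:R * (coord_sum u + e / 2 * (coord_sum u - 1) - 1) <=
   u 0 i + e / 2 * (u 0 i - n%:R^-1)).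
  by apply: h; rewrite /ball /= sub0r normrN gtr0_norm// ltr_pdivrMr// ltr_pMr// ltr1n.
rewrite height_bounds_lt; move: h1 h2 e2.
set s := e / 2; set k := n%:R^-1; set z := u 0 i; set c := coord_sum u => h1 h2 s0.
have sk : 0 < s * k by rewrite mulr_gt0.
by apply/andP; split; [case: (ltP 0 z)|case: (ltP _ z)] => //; nra.
Qed.

Lemma Bipyr_open : open (Bipyr R n).
Proof. by rewrite BipyrE; exact: open_above. Qed.

End Bipyramid.

(** * Two simplices sharing a facet *)

(** [edge] lists the vertices of the common facet.  In the charts,
    [apex false] is the image of the apex 0 of the bipyramid and [apex true]
    that of the apex with coordinates 2/n. *)
Record hinge (V : Type) (n : nat) := Hinge {
  edge : 'I_n -> V;
  apex : bool -> V;
  edge_inj : injective edge;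
  apex_neq : apex false <> apex true;
  apex_out : forall b, ~ range edge (apex b) }.

Section HingeChart.
Context {R : realType} {V : Type} {n : nat}.
Hypothesis n_gt0 : (0 < n)%N.
Local Notation E := (pw_space R V).
Local Notation D := (Bipyr R n).
Implicit Types (h k : hinge V n) (u : 'rV[R]_n) (w : V) (x y v : E) (b c : bool).

Let n0 : (n%:R : R) != 0.
Proof. by rewrite pnatr_eq0 -lt0n. Qed.

(** The union of the two open simplices and of their common open facet: at most
    one apex has a nonzero coordinate. *)
Definition hinge_open h : set E := [set y |
  [/\ forall i, 0 < (y (edge h i) : R), forall b, 0 <= (y (apex h b) : R),
      (y (apex h false) : R) * y (apex h true) = 0,
      forall w, ~ range (edge h) w -> (forall b, w <> apex h b) -> y w = 0
    & \sum_i (y (edge h i) : R) + y (apex h false) + y (apex h true) = 1]].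

Definition hinge_chart h u : E := fun w =>
  \sum_i (u 0 i - 2 / n%:R * height u) * delta (edge h i) w
  + (1 - coord_sum u + height u) * delta (apex h false) w
  + height u * delta (apex h true) w.

(** The inverse of the chart is the restriction of this linear map. *)
Definition hinge_coord h y : 'rV[R]_n :=
  \row_i (y (edge h i) + 2 / n%:R * y (apex h true)).

Lemma apex_edge h b i : apex h b <> edge h i.
Proof. by move=> e; apply: (@apex_out _ _ h b); exists i. Qed.

Lemma edge_apex h b i : edge h i <> apex h b.
Proof. by move=> e; apply: (@apex_edge h b i). Qed.

Lemma apexK h b : apex h b <> apex h (~~ b).
Proof. by case: b => //=; [move=> /esym|]; exact: apex_neq. Qed.

Lemma chart_edge h u i : hinge_chart h u (edge h i) = u 0 i - 2 / n%:R * height u.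
Proof.
rewrite /hinge_chart sum_delta_inj; last exact: edge_inj.
by rewrite !delta_neq ?mulr0 ?addr0//; exact: edge_apex.
Qed.

Lemma chart_apex h u b :
  hinge_chart h u (apex h b) = if b then height u else 1 - coord_sum u + height u.
Proof.
rewrite /hinge_chart sum_delta_out; last exact: apex_out.
case: b; rewrite delta_same (delta_neq (v := apex h _)).
- by rewrite mulr0 mulr1 !add0r.
- exact: (@apexK h true).
- by rewrite mulr0 mulr1 addr0 add0r.
- exact: (@apexK h false).
Qed.

Lemma chart_out h u w :
  ~ range (edge h) w -> (forall b, w <> apex h b) -> hinge_chart h u w = 0.
Proof.
by move=> we wa; rewrite /hinge_chart sum_delta_out// !delta_neq// !mulr0 !addr0.
Qed.

Lemma chartK h u : hinge_coord h (hinge_chart h u) = u.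
Proof. by apply/rowP => i; rewrite mxE chart_edge chart_apex subrK. Qed.

Lemma chart_hinge_open h u : D u -> hinge_open h (hinge_chart h u).
Proof.
rewrite BipyrE// => uD.
have ap b : hinge_chart h u (apex h b) =
    if b then height u else 1 - coord_sum u + height u by exact: chart_apex.
split.
- by move=> i; rewrite chart_edge subr_gt0.
- move=> b; rewrite ap; case: b; first exact: height_ge0.
  by rewrite /height; case: (leP 0 (coord_sum u - 1)); lra.
- rewrite !ap /height; case: (leP 0 (coord_sum u - 1)) => _; last by rewrite mulr0.
  by rewrite (_ : 1 - coord_sum u + _ = 0) ?mul0r//; ring.
- exact: chart_out.
- rewrite !ap; under eq_bigr do rewrite chart_edge.
  rewrite sumrB sumr_const card_ord -[X in _ - X]mulr_natr -/(coord_sum u).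
  by field.
Qed.

Lemma coord_sum_hinge h y :
  coord_sum (hinge_coord h y) = \sum_i y (edge h i) + 2 * y (apex h true).
Proof.
rewrite /coord_sum; under eq_bigr do rewrite mxE.
rewrite big_split/= sumr_const card_ord -[X in _ + X]mulr_natr; congr (_ + _).
by field.
Qed.

Lemma height_coord h y : hinge_open h y -> height (hinge_coord h y) = y (apex h true).
Proof.
move=> [_ y0 y00 _ y1]; have := y0 true; have := y0 false.
rewrite /height coord_sum_hinge.
move: y1 y00; set a := y (apex h false); set b := y (apex h true); set s := \sum_i _.
move=> y1 /eqP; rewrite mulf_eq0 => /orP[]/eqP z a0 b0.
  by rewrite max_r; lra.
by rewrite max_l; lra.
Qed.

Lemma coordK h y : hinge_open h y -> hinge_chart h (hinge_coord h y) = y.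
Proof.
move=> yo; have hy := height_coord yo; case: (yo) => [ye y0 y00 yz y1].
apply/funext => w; case: (pselect (range (edge h) w)) => [[i _ <-]|we].
  by rewrite chart_edge hy mxE addrK.
case: (pselect (exists b, w = apex h b)) => [[b ->]|wa]; last first.
  by rewrite chart_out// ?yz// => b wb; apply: wa; exists b.
rewrite chart_apex; case: b => //; rewrite hy.
by rewrite coord_sum_hinge; lra.
Qed.

Lemma hinge_open_coord h y : hinge_open h y -> D (hinge_coord h y).
Proof.
move=> yo; rewrite BipyrE// => i; rewrite (height_coord yo) mxE ltrDr.
by case: yo.
Qed.

Lemma chart_image h : hinge_chart h @` D = hinge_open h.
Proof.
apply/seteqP; split=> y; first by move=> [u Du <-]; exact: chart_hinge_open.
by move=> yo; exists (hinge_coord h y); [exact: hinge_open_coord|exact: coordK].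
Qed.

Lemma height_continuous : continuous (@height R n).
Proof.
move=> u; apply: (@continuous_max R _ (cst 0) (fun w : 'rV[R]_n => coord_sum w - 1)).
  exact: cst_continuous.
apply: (@continuousB _ _ _ (@coord_sum R n) (cst 1)); last exact: cst_continuous.
exact: coord_sum_continuous.
Qed.

Lemma chart_continuous h : continuous (hinge_chart h).
Proof.
apply: pw_continuous => w.
case: (pselect (range (edge h) w)) => [[i _ <-]|we].
  rewrite (_ : (fun _ => _) = fun u => u 0 i - 2 / n%:R * height u); last first.
    by apply/funext => u; exact: chart_edge.
  move=> u; apply: (@continuousB _ _ _ (fun u : 'rV[R]_n => u 0 i)
    (fun u => 2 / n%:R * height u)); first exact: coord_continuous.
  apply: (@continuousM _ _ (cst (2 / n%:R)) (@height R n)).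
    exact: cst_continuous.
  exact: height_continuous.
case: (pselect (exists b, w = apex h b)) => [[b ->]|wa]; last first.
  rewrite (_ : (fun _ => _) = cst 0); first exact: cst_continuous.
  by apply/funext => u; rewrite chart_out// => b wb; apply: wa; exists b.
case: b.
  rewrite (_ : (fun _ => _) = @height R n); first exact: height_continuous.
  by apply/funext => u; exact: chart_apex.
rewrite (_ : (fun _ => _) = fun u => 1 - coord_sum u + height u); last first.
  by apply/funext => u; exact: chart_apex.
move=> u; apply: (@continuousD _ _ _ (fun u : 'rV[R]_n => 1 - coord_sum u) (@height R n)).
  apply: (@continuousB R R^o _ (fun=> 1) (@coord_sum R n)); first exact: cst_continuous.
  exact: coord_sum_continuous.
exact: height_continuous.
Qed.

Lemma coord_continuous_hinge h : continuous (hinge_coord h : E -> 'rV[R]_n).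
Proof.
apply: mx_continuous => i j y.
rewrite (_ : (fun _ => _) =
    fun x : E => (x (edge h j) + 2 / n%:R * x (apex h true) : R)); last first.
  by apply/funext => x; rewrite mxE.
apply: (@continuousD _ _ _ (fun x : E => x (edge h j) : R)
  (fun x => 2 / n%:R * x (apex h true) : R)); first exact: eval_continuous.
apply: (@continuousM _ _ (cst (2 / n%:R)) (fun x : E => x (apex h true) : R)).
  exact: cst_continuous.
exact: eval_continuous.
Qed.

End HingeChart.

(** * Change of hinge *)

Section ChangeOfHinge.
Context {R : realType} {V : Type} {n : nat}.
Hypothesis n_gt0 : (0 < n)%N.
Local Notation E := (pw_space R V).
Local Notation D := (Bipyr R n).
Implicit Types (h k : hinge V n) (u : 'rV[R]_n) (w : V) (v : V -> R) (b c : bool).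

Let n0 : (n%:R : R) != 0.
Proof. by rewrite pnatr_eq0 -lt0n. Qed.

Let n2 : (2 / n%:R : R) *+ n = 2.
Proof. by rewrite -[LHS]mulr_natr divfK. Qed.

Definition side b u : Prop := if b then 1 <= coord_sum u else coord_sum u <= 1.

Definition strict_side b u : Prop :=
  if b then 1 < coord_sum u else coord_sum u < 1.

(** The partial derivatives of the chart, below the equator for [false] and
    above it for [true]. *)
Definition dir h b (i : 'I_n) : V -> R := fun w =>
  if b then delta (edge h i) w + delta (apex h true) w
            - 2 / n%:R * \sum_j delta (edge h j) w
  else delta (edge h i) w - delta (apex h false) w.

Lemma chart_side h b u u' w : side b u -> side b u' ->
  hinge_chart h u' w = hinge_chart h u w + \sum_i (u' - u) 0 i * dir h b i w.
Proof.
pose base := if b then 2 / n%:R * \sum_j delta (edge h j) w - delta (apex h true) w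
  else delta (apex h false) w : R.
suff chartE z : side b z -> hinge_chart h z w = base + \sum_i z 0 i * dir h b i w.
  move=> /chartE-> /chartE->; rewrite -addrA -big_split; congr (_ + _).
  by apply: eq_bigr => i _; rewrite !mxE /=; ring.
have sumE (a : R) : \sum_i z 0 i * (delta (edge h i) w + a) =
    \sum_i z 0 i * delta (edge h i) w + coord_sum z * a.
  rewrite /coord_sum mulr_suml -big_split.
  by apply: eq_bigr => i _; rewrite mulrDr.
have sumE' (a : R) : \sum_i (z 0 i - a) * delta (edge h i) w =
    \sum_i z 0 i * delta (edge h i) w - a * \sum_i delta (edge h i) w.
  by rewrite mulr_sumr -sumrB; apply: eq_bigr => i _; rewrite mulrBl.
rewrite /hinge_chart sumE' /side /dir /base; case: b {base} => z1.
  rewrite height_high//; under [X in _ = _ + X]eq_bigr do rewrite -addrA.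
  by rewrite sumE; ring.
by rewrite height_low// sumE; ring.
Qed.

(** The Jacobian matrix, on the side [b] of the equator of [h], of the change of
    coordinates from [h] to [k]. *)
Definition jac h k b : 'M[R]_n := \matrix_(i, j)
  (dir h b i (edge k j) + 2 / n%:R * dir h b i (apex k true)).

Lemma coord_side h k b u u' : side b u -> side b u' ->
  hinge_coord k (hinge_chart h u') =
  hinge_coord k (hinge_chart h u) + (u' - u) *m jac h k b.
Proof.
move=> ub u'b; apply/rowP => j; rewrite !mxE !(chart_side _ _ ub u'b).
rewrite mulrDr mulr_sumr addrACA -big_split; congr (_ + _).
apply: eq_bigr => i _; rewrite [jac _ _ _ _ _]mxE /=.
by rewrite mulrDr; congr (_ + _); rewrite mulrCA.
Qed.

(** The Euclidean product of [v] with the finitely supported function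
    [dir h b i], written so as to make sense for any [v]. *)
Definition slope h v b i : R :=
  if b then v (edge h i) + v (apex h true) - 2 / n%:R * \sum_j v (edge h j)
  else v (edge h i) - v (apex h false).

Lemma slope_const h b i : slope h (fun=> 1) b i = 0.
Proof.
rewrite /slope; case: b; last exact: subrr.
by rewrite sumr_const card_ord; field.
Qed.

Lemma dir_edge h b i j :
  dir h b i (edge h j) = (i == j)%:R - (if b then 2 / n%:R else 0).
Proof.
have dE : delta (edge h i) (edge h j) = (i == j)%:R :> R.
  case: eqVneq => [->|ij]; first exact: delta_same.
  by rewrite delta_neq// => /edge_inj ji; rewrite ji eqxx in ij.
rewrite /dir; case: b; rewrite dE delta_neq ?addr0//; try exact: edge_apex.
have -> : \sum_l delta (edge h l) (edge h j) = 1 :> R.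
  have := @sum_delta_inj R V n (edge h) (fun=> 1) j (@edge_inj _ _ h).
  by under eq_bigr do rewrite mul1r.
by rewrite mulr1.
Qed.

Lemma dir_apex h b i : dir h b i (apex h b) = if b then 1 else -1.
Proof.
rewrite /dir; case: b; rewrite delta_same (delta_neq (v := edge h i));
  try exact: apex_edge.
  rewrite big1 ?mulr0 ?subr0 ?add0r// => j _; rewrite delta_neq//; exact: apex_edge.
by rewrite sub0r.
Qed.

(** The edge vectors of a simplex at a vertex have scalar products
    [1 + delta_ij].  Below the equator the coordinate vectors are the edge
    vectors [e_i - p]; above it they are the mirror images of the edge vectors
    [e_i - q], whose component along the normal [q - 1/n sum_j e_j] of the
    common facet is negated. *)
Lemma slope_dir h b i j : slope h (dir h b i) b j = 1 + (i == j)%:R.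
Proof.
rewrite /slope; case: b; rewrite dir_edge dir_apex; last by rewrite subr0 opprK addrC.
under eq_bigr do rewrite dir_edge.
rewrite sumrB sumr_const card_ord (bigD1 i)//= eqxx big1; last first.
  by move=> l li; rewrite eq_sym (negPf li).
by rewrite n2 /=; ring.
Qed.

(** The Euclidean product of [sum_i x_i (e_i - p)] and [sum_i y_i (e_i - p)]. *)
Definition gdot (x y : 'rV[R]_n) : R :=
  \sum_i x 0 i * y 0 i + coord_sum x * coord_sum y.

(** The vertices of the simplex of [k] on the side [c] carry [dir h b i], so
    that restricting all functions to these vertices loses nothing. *)
Definition carries k c h b := forall w,
  range (edge h) w \/ w = apex h b -> range (edge k) w \/ w = apex k c.

Section Carried.
Variables (h k : hinge V n) (b c : bool).
Hypothesis kh : carries k c h b.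

Let dot v (x : V -> R) :=
  \sum_j v (edge k j) * x (edge k j) + v (apex k c) * x (apex k c).

Lemma dot_delta v w : range (edge k) w \/ w = apex k c -> dot v (delta w) = v w.
Proof.
rewrite /dot => -[[j _ <-]|->].
  rewrite delta_neq ?mulr0 ?addr0; last exact: apex_edge.
  rewrite (bigD1 j)//= delta_same mulr1 big1 ?addr0// => l lj.
  by rewrite delta_neq ?mulr0// => /edge_inj jl; rewrite jl eqxx in lj.
rewrite delta_same mulr1 big1 ?add0r// => j _.
by rewrite delta_neq ?mulr0//; exact: edge_apex.
Qed.

Lemma dot_dir v i : dot v (dir h b i) = slope h v b i.
Proof.
have de j : dot v (delta (edge h j)) = v (edge h j).
  by apply/dot_delta/kh; left; exists j.
have da : dot v (delta (apex h b)) = v (apex h b) by apply/dot_delta/kh; right.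
have dotD x y : dot v (fun w => x w + y w) = dot v x + dot v y.
  rewrite /dot mulrDr addrACA -big_split; congr (_ + _).
  by apply: eq_bigr => j _; rewrite mulrDr.
have dotZ a x : dot v (fun w => a * x w) = a * dot v x.
  rewrite /dot mulrDr mulr_sumr; congr (_ + _); last by ring.
  by apply: eq_bigr => j _; ring.
have dotN x : dot v (fun w => - x w) = - dot v x.
  rewrite -mulN1r -dotZ; congr (dot v _).
  by apply/funext => w; rewrite mulN1r.
have dot_sum (m : nat) (x : 'I_m -> V -> R) :
    dot v (fun w => \sum_j x j w) = \sum_j dot v (x j).
  rewrite /dot big_split /= -mulr_sumr exchange_big; congr (_ + _).
  by apply: eq_bigr => j _; rewrite mulr_sumr.
rewrite /slope /dir; case: (b) da => da.
  rewrite !dotD dotN dotZ dot_sum de da; congr (_ - _ * _).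
  by apply: eq_bigr => j _; exact: de.
by rewrite dotD dotN de da.
Qed.

Lemma dir_off i : dir h b i (apex k (~~ c)) = 0.
Proof.
have off w : range (edge h) w \/ w = apex h b -> delta w (apex k (~~ c)) = 0 :> R.
  move=> /kh kw; rewrite delta_neq// => aw; case: kw => [[j _ jw]|wa].
    by apply: (@apex_edge _ _ k (~~ c) j); rewrite jw.
  by apply: (@apexK _ _ k c); rewrite -wa.
have offe j : delta (edge h j) (apex k (~~ c)) = 0 :> R by apply: off; left; exists j.
rewrite /dir; case: (b) (off (apex h b) (or_intror erefl)) => /= offa.
  by rewrite offe offa big1// => *; rewrite ?mulr0 ?subr0 ?addr0.
by rewrite offe offa subrr.
Qed.

(** On vectors that are carried by one simplex of [k] and have coordinates of
    sum 0, [hinge_coord k] is an isometry from the Euclidean product to [gdot]. *)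
Lemma gdot_jac i j : gdot (row i (jac h k b)) (row j (jac h k b)) = 1 + (i == j)%:R.
Proof.
have sum0 l : \sum_m dir h b l (edge k m) + dir h b l (apex k c) = 0.
  have := dot_dir (fun=> 1) l; rewrite slope_const /dot mul1r.
  by under eq_bigr do rewrite mul1r.
rewrite -(slope_dir h b i j) -dot_dir /dot /gdot.
have rowE l m : row l (jac h k b) 0 m =
    dir h b l (edge k m) + 2 / n%:R * dir h b l (apex k true) by rewrite !mxE.
have sumE l : coord_sum (row l (jac h k b)) =
    \sum_m dir h b l (edge k m) + 2 * dir h b l (apex k true).
  rewrite /coord_sum; under eq_bigr do rewrite rowE.
  by rewrite big_split /= sumr_const card_ord -mulrnAl n2.
rewrite !sumE.
have -> : \sum_m row i (jac h k b) 0 m * row j (jac h k b) 0 m =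
    \sum_m dir h b i (edge k m) * dir h b j (edge k m)
    + 2 / n%:R * dir h b j (apex k true) * \sum_m dir h b i (edge k m)
    + 2 / n%:R * dir h b i (apex k true) * \sum_m dir h b j (edge k m)
    + 2 * (2 / n%:R) * dir h b i (apex k true) * dir h b j (apex k true).
  have -> : 2 * (2 / n%:R) * dir h b i (apex k true) * dir h b j (apex k true) =
      \sum_(m < n) (2 / n%:R * dir h b i (apex k true)) *
                   (2 / n%:R * dir h b j (apex k true)).
    by rewrite sumr_const card_ord -mulrnAl -mulrnAl n2; ring.
  rewrite !mulr_sumr -!big_split; apply: eq_bigr => m _; rewrite !rowE /=; ring.
have /eqP := sum0 i; have /eqP := sum0 j; have := dir_off i; have := dir_off j.
rewrite !addr_eq0; case: (c) => /= oi oj /eqP -> /eqP ->; first by ring.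
by rewrite oi oj; ring.
Qed.

End Carried.
End ChangeOfHinge.

(** * Overlapping charts *)

Lemma inj_range_eq (V : Type) (n : nat) (s t : 'I_n -> V) :
  injective t -> (forall i, range s (t i)) -> range s = range t.
Proof.
move=> tI st; have [r rP] : exists r : 'I_n -> 'I_n, forall i, s (r i) = t i.
  pose r i := projT1 (cid2 (st i)).
  by exists r => i; rewrite /r; case: cid2.
have rI : injective r by move=> i j e; apply: tI; rewrite -!rP e.
apply/seteqP; split=> w [i _ <-]; last by exists (r i).
by exists (invF rI i); rewrite // -rP f_invF.
Qed.

Section Overlap.
Context {R : realType} {V : Type} {n : nat}.
Hypothesis n_gt0 : (0 < n)%N.
Local Notation E := (pw_space R V).
Local Notation D := (Bipyr R n).
Variables (M : set E).
Implicit Types (h k : hinge V n) (u : 'rV[R]_n) (w : V) (y : E) (b c : bool).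

(** Near the open facet of [h], the space [M] consists of the two simplices of
    [h] and of nothing else. *)
Definition hinge_of h : Prop :=
  [set y | M y /\ forall i, 0 < (y (edge h i) : R)] = hinge_open h.

Lemma hinge_ofP h y : hinge_of h ->
  M y -> (forall i, 0 < (y (edge h i) : R)) -> hinge_open h y.
Proof. by rewrite /hinge_of => <-. Qed.

Lemma hinge_open_sub h y : hinge_of h -> hinge_open h y -> M y.
Proof. by rewrite /hinge_of => <- []. Qed.

Lemma hinge_open_supp h y w : hinge_open h y -> y w != 0 :> R ->
  range (edge h) w \/ exists2 b, w = apex h b & y (apex h b) != 0 :> R.
Proof.
move=> [_ _ _ yz _] yw; case: (pselect (range (edge h) w)) => [|we]; first by left.
case: (pselect (exists b, w = apex h b)) => [[b wb]|wa].
  by right; exists b => //; rewrite -wb.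
by rewrite yz ?eqxx// in yw => b wb; apply: wa; exists b.
Qed.

Section TwoHinges.
Variables (h k : hinge V n).
Hypotheses (hM : hinge_of h) (kM : hinge_of k).

Lemma equator_edges u : D u -> coord_sum u = 1 -> hinge_open k (hinge_chart h u) ->
  range (edge h) = range (edge k).
Proof.
move=> Du u1 ku; apply: inj_range_eq; first exact: edge_inj.
move=> i; have [/(_ i) + _ _ _ _] := ku => /gt_eqF/negbT.
move=> /(hinge_open_supp (chart_hinge_open n_gt0 h Du))[//|[b _]].
by rewrite chart_apex height_low ?u1//; case: b; rewrite ?subrr ?addr0 eqxx.
Qed.

(** On the equator the two hinges have the same facet, hence meet in all the
    points where the coordinates on this facet are positive. *)
Lemma strict_witness b u : D u -> side b u -> hinge_open k (hinge_chart h u) ->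
  exists u', [/\ D u', strict_side b u' & hinge_open k (hinge_chart h u')].
Proof.
move=> Du ub ku; have [u1|u1] := eqVneq (coord_sum u) 1; last first.
  exists u; split=> //; move: ub u1; rewrite /side /strict_side.
  by case: b => ub u1; rewrite lt_neqAle ub ?u1//= eq_sym u1.
have n0 : (n%:R : R) != 0 by rewrite pnatr_eq0 -lt0n.
have ni0 : 0 < (n%:R^-1 : R) by rewrite invr_gt0 ltr0n.
(* Points of the axis of the bipyramid, on either side of the equator. *)
pose a : R := if b then 3 / 2 else 1 / 2.
pose u' : 'rV[R]_n := const_mx (n%:R^-1 * a).
have s' : coord_sum u' = a by rewrite coord_sum_const mulrA mulfV// mul1r.
have Du' : D u'.
  rewrite BipyrE// => i; rewrite mxE height_bounds_lt// s' /a.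
  by case: (b); apply/andP; split; nra.
exists u'; split=> //; first by rewrite /strict_side s' /a; case: b {a ub u' s' Du'}; lra.
have hu' := chart_hinge_open n_gt0 h Du'.
apply: hinge_ofP => // [|i]; first exact: hinge_open_sub hu'.
have : range (edge k) (edge k i) by exists i.
rewrite -(equator_edges Du u1 ku) => -[j _ <-].
by case: hu'.
Qed.

Lemma overlap_carries b u : D u -> side b u -> hinge_open k (hinge_chart h u) ->
  exists c, carries k c h b.
Proof.
move=> Du ub /(strict_witness Du ub)[u' [Du' ub' ku']].
have hu' := chart_hinge_open n_gt0 h Du'.
pose x := hinge_chart h u'; pose c := x (apex k true) != 0 :> R.
exists c => w hw.
have xw : x w != 0.
  case: hw => [[i _ <-]|->]; first by case: hu' => /(_ i)/gt_eqF/negbT.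
  rewrite /x chart_apex; move: ub'; rewrite /strict_side.
  case: (b) => u1; first by rewrite height_high ?ltW// subr_eq0 gt_eqF.
  by rewrite height_low ?ltW// addr0 subr_eq0 gt_eqF.
have [?|[c' -> xc']] := hinge_open_supp ku' xw; [by left|right].
congr (apex k _); have [_ _ /eqP + _ _] := ku'; rewrite mulf_eq0 /c.
by case: c' xc' => [-> //|/negPf -> /= ->].
Qed.

(** The two matrices differ by the image under [hinge_coord k] of
    [p + q - 2/n sum_i e_i], which vanishes when [k] has the facet [e] and
    its upper apex is [p] or [q]. *)
Lemma equator_jac u : D u -> coord_sum u = 1 -> hinge_open k (hinge_chart h u) ->
  jac h k true = jac h k false :> 'M[R]_n.
Proof.
move=> Du u1 ku; have ee := equator_edges Du u1 ku.
have opp b : exists c, apex h b = apex k c.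
  have ub : side b u by rewrite /side u1; case: (b).
  have [c kh] := overlap_carries Du ub ku; exists c.
  by have [|//] := kh _ (or_intror erefl); rewrite -ee => /apex_out.
have [b hb] : exists b, apex k true = apex h b.
  have [cf ef] := opp false; have [ct et] := opp true.
  have := @apex_neq _ _ h; rewrite ef et.
  by case: cf ef => ef; [exists false|case: ct et => // et; exists true].
apply/matrixP => i j; rewrite !mxE.
have [l _ <-] : range (edge h) (edge k j) by rewrite ee; exists j.
rewrite !dir_edge hb; case: b {hb}.
  rewrite dir_apex /dir !delta_neq; try exact: apex_edge; last exact: (@apexK _ _ h true).
  by ring.
rewrite dir_apex /dir delta_neq; last exact: apex_edge.
rewrite delta_neq; last exact: (@apexK _ _ h false).
rewrite big1 => [|m _]; last by rewrite delta_neq//; exact: apex_edge.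
by ring.
Qed.

(** Where a chart crosses the equator, the change of coordinates does not bend:
    its one-sided derivatives agree by [equator_jac]. *)
Lemma overlap_affine u : D u -> hinge_open k (hinge_chart h u) ->
  exists2 b, side b u & \forall u' \near u,
    hinge_coord k (hinge_chart h u') =
    hinge_coord k (hinge_chart h u) + (u' - u) *m jac h k b.
Proof.
move=> Du ku.
have near_side b : strict_side b u -> \forall u' \near u, side b u'.
  move=> ub; have : \forall u' \near u, strict_side b u'.
    move: ub; rewrite /strict_side; case: b => ub.
      exact: (@coord_sum_continuous R n u [set r | 1 < r]
        (open_nbhs_nbhs (conj (@open_gt _ 1) ub))).
    exact: (@coord_sum_continuous R n u [set r | r < 1]
      (open_nbhs_nbhs (conj (@open_lt _ 1) ub))).
  by apply: filterS => u'; rewrite /side /strict_side; case: (b) => /ltW.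
have [u1|u1|u1] := ltgtP (coord_sum u) 1.
- exists false; first exact: ltW.
  by apply: filterS (near_side false u1) => u'; apply: coord_side => //; exact: ltW.
- exists true; first exact: ltW.
  by apply: filterS (near_side true u1) => u'; apply: coord_side => //; exact: ltW.
- exists false; first by rewrite /side u1.
  near=> u'; have [l|/ltW l] := leP (coord_sum u') 1.
    by apply: coord_side; rewrite /side ?u1.
  rewrite -(equator_jac Du u1 ku).
  by apply: coord_side; rewrite /side ?u1.
Unshelve. all: by end_near. Qed.

End TwoHinges.
End Overlap.

(** * The scalar product of coordinate vectors *)

Section Gdot.
Context {R : realType} {n : nat}.

Lemma row_functional (F : 'rV[R]_n -> R) (a : 'rV[R]_n) :
  (forall c x y, F (c *: x + y) = c * F x + F y) ->
  F a = \sum_i a 0 i * F (delta_mx 0 i).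
Proof.
move=> FL; have F0 : F 0 = 0.
  have := FL 1 0 0; rewrite scale1r addr0 mul1r => /eqP.
  by rewrite -subr_eq0 opprD addNKr oppr_eq0 => /eqP.
rewrite [in LHS](row_sum_delta a).
elim/big_ind2: _ => [//|x s y t <- <-|i _]; last first.
  by rewrite -[in LHS](addr0 (_ *: _)) FL F0 addr0.
by rewrite -[s in LHS]scale1r FL mul1r.
Qed.

Lemma gdot_comb (c : R) (x y z : 'rV[R]_n) :
  gdot (c *: x + y) z = c * gdot x z + gdot y z.
Proof.
rewrite /gdot coord_sumD coord_sumZ mulrDr mulr_sumr.
have -> : \sum_i (c *: x + y) 0 i * z 0 i =
    \sum_i c * (x 0 i * z 0 i) + \sum_i y 0 i * z 0 i.
  by rewrite -big_split; apply: eq_bigr => i _; rewrite !mxE /= mulrDl mulrA.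
by ring.
Qed.

Lemma gdotC (x y : 'rV[R]_n) : gdot x y = gdot y x.
Proof.
by rewrite /gdot mulrC; congr (_ + _); apply: eq_bigr => i _; rewrite mulrC.
Qed.

Lemma gdot_comb_r (c : R) (x y z : 'rV[R]_n) :
  gdot z (c *: x + y) = c * gdot z x + gdot z y.
Proof. by rewrite ![gdot z _]gdotC gdot_comb. Qed.

Lemma gdot_delta (i j : 'I_n) :
  gdot (delta_mx 0 i : 'rV[R]_n) (delta_mx 0 j) = 1 + (i == j)%:R.
Proof.
rewrite /gdot !coord_sum_delta mulr1 addrC; congr (_ + _).
rewrite (bigD1 i)//= big1 ?addr0 => [|l li]; first by rewrite !mxE !eqxx mul1r.
by rewrite !mxE (negPf li) mul0r.
Qed.

Lemma gdot_gt0 (x : 'rV[R]_n) : x != 0 -> 0 < gdot x x.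
Proof.
move=> x0; rewrite /gdot -expr2 ltr_pwDl ?sqr_ge0//.
have [i xi] : exists i, x 0 i != 0.
  apply/existsP; apply: contraNT x0 => /existsPn x0.
  by apply/eqP/rowP => i; rewrite mxE; apply/eqP/negPn.
rewrite (bigD1 i)//= ltr_pwDl -?expr2 ?exprn_even_gt0// sumr_ge0// => j _.
by rewrite -expr2 sqr_ge0.
Qed.

End Gdot.

(** * Manifolds glued from bipyramids *)

Section HingedSpace.
Context {R : realType} {V : Type} {n : nat}.
Hypothesis n_gt0 : (0 < n)%N.
Local Notation E := (pw_space R V).
Local Notation D := (Bipyr R n).
Variables (M : set E) (Phi : set ('rV[R]_n -> E)).
Hypothesis hinged : forall phi, Phi phi ->
  exists2 h : hinge V n, hinge_of M h & phi = hinge_chart h.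
Hypothesis covered : forall x, M x ->
  exists phi u, [/\ Phi phi, D u & phi u = x].
Implicit Types (h k : hinge V n) (u w : 'rV[R]_n) (x y : E)
  (phi psi chi : 'rV[R]_n -> E).

Local Notation tr := (transition D).

Lemma chart_sub phi u : Phi phi -> D u -> M (phi u).
Proof.
move=> /hinged[h hM ->] Du; apply: (hinge_open_sub hM).
exact: chart_hinge_open.
Qed.

Lemma chart_inj phi : Phi phi -> injective phi.
Proof. by move=> /hinged[h _ ->]; exact: (can_inj (chartK h)). Qed.

Lemma transitionK phi psi u : Phi psi -> (psi @` D) (phi u) ->
  D (tr phi psi u) /\ psi (tr phi psi u) = phi u.
Proof.
move=> Ppsi [w Dw wu]; apply: (@xgetPex _ 0 [set w | D w /\ psi w = phi u]).
by exists w.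
Qed.

Lemma transition_unique phi psi u w : Phi psi -> D w -> psi w = phi u ->
  tr phi psi u = w.
Proof.
move=> Ppsi Dw wu; have [|_ e] := @transitionK phi psi u Ppsi; first by exists w.
by apply: (chart_inj Ppsi); rewrite e.
Qed.

Lemma overlap_near phi psi u : Phi phi -> Phi psi -> D u -> (psi @` D) (phi u) ->
  \forall w \near u, D w /\ (psi @` D) (phi w).
Proof.
move=> /hinged[h hM ->] /hinged[k kM ->] Du; rewrite !chart_image// => ku.
have nD : \forall w \near u, D w.
  by apply: open_nbhs_nbhs; split=> //; exact: Bipyr_open.
have npos : \forall w \near u, forall i, 0 < (hinge_chart h w (edge k i) : R).
  apply: (@filter_forall 'rV[R]_n 'I_n
    (fun i w => 0 < (hinge_chart h w (edge k i) : R)) (nbhs u)) => i.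
  have nb : nbhs (hinge_chart h u) [set y | 0 < (y (edge k i) : R)].
    apply: open_nbhs_nbhs; split; first exact: open_eval_pos.
    by case: ku => /(_ i).
  exact: (@chart_continuous R V n h u _ nb).
apply: filterS2 nD npos => w Dw wpos; split=> //; apply: (hinge_ofP kM) => //.
by apply: (hinge_open_sub hM); exact: chart_hinge_open.
Qed.

Lemma transition_near phi psi u : Phi phi -> Phi psi -> D u -> (psi @` D) (phi u) ->
  exists2 A : 'M[R]_n,
    \forall w \near u, tr phi psi w = tr phi psi u + (w - u) *m A &
    forall i j, gdot (row i A) (row j A) = 1 + (i == j)%:R.
Proof.
move=> Pphi Ppsi Du ku; have near_ku := overlap_near Pphi Ppsi Du ku.
move: ku near_ku; have [h hM phiE] := hinged Pphi; have [k kM psiE] := hinged Ppsi.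
rewrite psiE phiE chart_image// => ku near_ku.
have trE w : hinge_open k (hinge_chart h w) ->
    tr (hinge_chart h) (hinge_chart k) w = hinge_coord k (hinge_chart h w).
  move=> kw; rewrite -phiE -psiE; apply: transition_unique => //.
    by rewrite phiE; exact: hinge_open_coord.
  by rewrite psiE phiE coordK.
have [b ub aff] := overlap_affine n_gt0 hM kM Du ku.
exists (jac h k b); last first.
  by have [c kh] := overlap_carries n_gt0 hM kM Du ub ku; exact: gdot_jac kh.
by apply: filterS2 near_ku aff => w [_ kw] e; rewrite !trE.
Qed.

Lemma jacobian_near phi psi u : Phi phi -> Phi psi -> D u -> (psi @` D) (phi u) ->
  \forall w \near u, tr phi psi w = tr phi psi u + (w - u) *m 'J (tr phi psi) u.
Proof.
move=> Pphi Ppsi Du ku; have [A nA _] := transition_near Pphi Ppsi Du ku.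
by rewrite (near_affine_jacobian nA).
Qed.

Lemma gdot_jacobian phi psi u i j :
  Phi phi -> Phi psi -> D u -> (psi @` D) (phi u) ->
  gdot (row i ('J (tr phi psi) u)) (row j ('J (tr phi psi) u)) = 1 + (i == j)%:R.
Proof.
move=> Pphi Ppsi Du ku; have [A nA gA] := transition_near Pphi Ppsi Du ku.
by rewrite (near_affine_jacobian nA).
Qed.

Lemma jacobian_id phi u : Phi phi -> D u -> 'J (tr phi phi) u = 1%:M.
Proof.
move=> Pphi Du; apply: near_affine_jacobian.
have trE w : D w -> tr phi phi w = w by move=> Dw; exact: transition_unique.
have nD : \forall w \near u, D w.
  by apply: open_nbhs_nbhs; split=> //; exact: Bipyr_open.
by apply: filterS nD => w Dw; rewrite !trE// mulmx1 addrC subrK.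
Qed.

Lemma jacobian_comp phi psi chi u : Phi phi -> Phi psi -> Phi chi -> D u ->
  (psi @` D) (phi u) -> (chi @` D) (phi u) ->
  'J (tr phi chi) u = 'J (tr phi psi) u *m 'J (tr psi chi) (tr phi psi u).
Proof.
move=> Pphi Ppsi Pchi Du psiu chiu; apply: near_affine_jacobian.
have [Dv vE] := transitionK Ppsi psiu; set v := tr phi psi u in Dv vE *.
have chiv : (chi @` D) (psi v) by rewrite vE.
have n1 := overlap_near Pphi Ppsi Du psiu.
have n2 := overlap_near Pphi Pchi Du chiu.
have n3 := jacobian_near Pphi Ppsi Du psiu.
have n4 := jacobian_near Ppsi Pchi Dv chiv.
have trc := near_affine_continuous n3.
have n5 : \forall w \near u, tr psi chi (tr phi psi w) =
    tr psi chi v + (tr phi psi w - v) *m 'J (tr psi chi) v by exact: (trc _ n4).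
have n12 : \forall w \near u, (psi @` D) (phi w) /\ (chi @` D) (phi w).
  by apply: filterS2 n1 n2 => w [_ ?] [_ ?].
have trE w : (psi @` D) (phi w) -> (chi @` D) (phi w) ->
    tr phi chi w = tr psi chi (tr phi psi w).
  move=> pw cw; have [Dw wE] := transitionK Ppsi pw.
  have cw' : (chi @` D) (psi (tr phi psi w)) by rewrite wE.
  have [Dz zE] := transitionK Pchi cw'.
  by apply: transition_unique => //; rewrite zE wE.
apply: filterS3 n12 n3 n5 => w [pw cw] e3 e5.
rewrite (trE w)// (trE u)// -/v e5 e3 mulmxA; congr (_ + _ *m _).
by rewrite addrC addKr.
Qed.

Lemma hinged_parametrization phi : Phi phi -> parametrization M D phi.
Proof.
move=> Pphi; have [h hM phiE] := hinged Pphi; split.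
- by move=> u w _ _; exact: chart_inj.
- by move=> x [u Du <-]; exact: chart_sub.
- by rewrite phiE; apply: continuous_subspaceT; exact: chart_continuous.
- move=> W oW WD.
  exists ([set y | forall i, 0 < (y (edge h i) : R)] `&` hinge_coord h @^-1` W).
    apply: openI.
      rewrite openE => y ypos; apply: (@filter_forall E 'I_n
        (fun i y => 0 < (y (edge h i) : R)) (nbhs y)) => i.
      by apply: open_nbhs_nbhs; split; [exact: open_eval_pos|exact: ypos].
    by apply: open_comp => // y _; exact: coord_continuous_hinge.
  apply/seteqP; split=> y.
    move=> [u Wu <-]; split; last by apply: chart_sub => //; exact: WD.
    have : hinge_open h (phi u) by rewrite phiE; apply: chart_hinge_open => //; exact: WD.
    by case=> pos _ _ _ _; split=> //=; rewrite phiE chartK.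
  move=> [[ypos Wy] My]; exists (hinge_coord h y) => //.
  by rewrite phiE coordK//; exact: (hinge_ofP hM My ypos).
Qed.

Lemma transition_smooth phi psi i : Phi phi -> Phi psi ->
  smooth_on (D `&` phi @^-1` (psi @` D)) (fun u => tr phi psi u 0 i).
Proof.
move=> Pphi Ppsi; apply: smooth_locally_affine => u [Du ku].
exists (col i ('J (tr phi psi) u)).
have := jacobian_near Pphi Ppsi Du ku.
apply: filterS => w e; rewrite {1}e mxE; congr (_ + _).
by rewrite !mxE; apply: eq_bigr => j _; rewrite !mxE.
Qed.


(** A chart meets only charts whose equators have their vertices among the
    [n + 2] vertices of the first one, so chains of charts reach countably
    many vertices. *)
Lemma hinged_second_countable x :
  M x -> @second_countable (set_type (connected_component M x)).
Proof.
move=> Mx; pose star h := range (edge h) `|` range (apex h).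
pose J := [set F : set V | exists2 h : hinge V n, hinge_of M h & F = range (edge h)].
pose O (F : set V) := [set y : E | forall v, F v -> 0 < (y v : R)].
have finite_star h : finite_set (star h).
  by rewrite finite_setU; split; exact: finite_image.
have starP h y (v : V) : hinge_of M h -> M y -> O (range (edge h)) y ->
    y v <> 0 -> star h v.
  move=> hM My Oy /eqP yv; have ho : hinge_open h y.
    by apply: (hinge_ofP hM My) => i; apply: Oy; exists i.
  have [?|[b -> _]] := hinge_open_supp ho yv; [by left|by right; exists b].
have [|||K [Kc KJ] CK] := @component_countable_cover _ M _ J O x Mx.
- move=> _ [h hM ->]; rewrite openE => y Oy.
  have : \forall z \near (y : E), forall i, 0 < (z (edge h i) : R).
    apply: (@filter_forall E 'I_n (fun i z => 0 < (z (edge h i) : R)) (nbhs y)) => i.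
    by apply: open_nbhs_nbhs; split; [exact: open_eval_pos|apply: Oy; exists i].
  by apply: filterS => z zpos _ [i _ <-]; exact: zpos.
- move=> y My; have [phi [u [Pphi Du uy]]] := covered My.
  have [h hM phiE] := hinged Pphi; exists (range (edge h)); first by exists h.
  move=> _ [i _ <-]; rewrite -uy phiE.
  by case: (chart_hinge_open n_gt0 h Du) => /(_ i).
- move=> _ [h hM ->]; have starC := finite_set_countable (finite_star h).
  apply: sub_countable (countable_finite_subset starC).
  apply: subset_card_le => _ [[k kM ->] [y My [hy ky]]]; split.
    move=> _ [i _ <-]; apply: (starP h y) => //.
    by apply/eqP; rewrite gt_eqF//; apply: ky; exists i.
  exact: finite_image.
pose S := \bigcup_(F in K) [set v | exists2 y, M y & O F y /\ y v <> 0].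
apply: (@pw_second_countable R V S).
  apply: bigcup_countable => // F KF; have [h hM ->] := KJ F KF.
  apply: sub_countable (finite_set_countable (finite_star h)).
  by apply: subset_card_le => w [y My [Oy yw]]; exact: (starP h y).
move=> y w Cy Sw; apply: contrapT => yw; apply: Sw.
have [F KF Oy] := CK y Cy; exists F => //; exists y => //.
exact: connected_component_sub Cy.
Qed.

Lemma hinged_smooth_manifold : smooth_manifold M D Phi.
Proof.
split.
- exact: pw_subspace_hausdorff.
- exact: hinged_second_countable.
- exact: Bipyr_open.
- split; first exact: hinged_parametrization.
  apply/seteqP; split=> x.
    by move=> /covered[phi [u [Pphi Du ux]]]; exists phi => //; exists u.
  by move=> [phi Pphi [u Du <-]]; exact: chart_sub.
- by move=> phi psi Pphi Ppsi i; exact: transition_smooth.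
Qed.

(** * The metric in coordinates *)

(** The tangent vector at [phi u] with coordinates [a] in [phi]. *)
Definition tvec_of phi u (a : 'rV[R]_n) : @tvec R n E := fun psi =>
  if `[< Phi psi /\ (psi @` D) (phi u) >] then a *m 'J (tr phi psi) u else 0.

Lemma tvec_ofE phi u a psi : Phi psi -> (psi @` D) (phi u) ->
  tvec_of phi u a psi = a *m 'J (tr phi psi) u.
Proof. by move=> Ppsi psiu; rewrite /tvec_of asboolT. Qed.

Lemma coord_tvecE phi u i :
  coord_tvec D Phi phi u i = tvec_of phi u (delta_mx 0 i).
Proof.
by apply/funext => psi; rewrite /coord_tvec /tvec_of; case: asboolP => // _; rewrite rowE.
Qed.

Lemma tvec_of_tangent phi u a : Phi phi -> D u ->
  tangent D Phi (phi u) (tvec_of phi u a).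
Proof.
move=> Pphi Du; split=> [psi npsi|psi chi v Ppsi Pchi Dv vE chiu].
  by rewrite /tvec_of asboolF.
have psiu : (psi @` D) (phi u) by exists v.
rewrite (tvec_ofE a Ppsi psiu) (tvec_ofE a Pchi chiu).
rewrite (jacobian_comp Pphi Ppsi Pchi Du psiu chiu) mulmxA.
by rewrite (transition_unique Ppsi Dv vE).
Qed.

Lemma tangentE phi u X : Phi phi -> D u -> tangent D Phi (phi u) X ->
  X = tvec_of phi u (X phi).
Proof.
move=> Pphi Du [X0 XJ]; apply/funext => psi; rewrite /tvec_of.
by case: asboolP => [[Ppsi psiu]|/X0//]; exact: XJ.
Qed.

Lemma tvec_of_self phi u a : Phi phi -> D u -> tvec_of phi u a phi = a.
Proof.
move=> Pphi Du; have phiu : (phi @` D) (phi u) by exists u.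
by rewrite (tvec_ofE a Pphi phiu) (jacobian_id Pphi Du) mulmx1.
Qed.

Lemma tvec_of_comb phi u (c : R) a b :
  tvec_of phi u (c *: a + b) =
  tvec_add (tvec_scale c (tvec_of phi u a)) (tvec_of phi u b).
Proof.
apply/funext => psi; rewrite /tvec_add /tvec_scale /tvec_of; case: asboolP => _.
  by rewrite mulmxDl -scalemxAl.
by rewrite scaler0 addr0.
Qed.

Section Metric.
Variable g : E -> @tvec R n E -> @tvec R n E -> R.
Hypothesis g_bilinear : forall x, M x -> bilinear_at D Phi g x.

Lemma metric_gram phi u X Y : Phi phi -> D u ->
  (forall i j, gram D Phi g phi u i j = 1 + (i == j)%:R) ->
  tangent D Phi (phi u) X -> tangent D Phi (phi u) Y ->
  g (phi u) X Y = gdot (X phi) (Y phi).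
Proof.
move=> Pphi Du gramE tX tY; have [gl gr] := g_bilinear (chart_sub Pphi Du).
rewrite [in LHS](tangentE Pphi Du tX) [in LHS](tangentE Pphi Du tY).
move: (X phi) (Y phi) => a b.
have tt := @tvec_of_tangent phi u _ Pphi Du.
rewrite (row_functional
  (F := fun a => g (phi u) (tvec_of phi u a) (tvec_of phi u b))); last first.
  by move=> c x y; rewrite tvec_of_comb gl.
rewrite [RHS](row_functional (F := fun a => gdot a b)); last first.
  by move=> *; rewrite gdot_comb.
apply: eq_bigr => i _; congr (_ * _).
rewrite (row_functional (F := fun b =>
  g (phi u) (tvec_of phi u (delta_mx 0 i)) (tvec_of phi u b))); last first.
  by move=> c x y; rewrite tvec_of_comb gr.
rewrite [RHS](row_functional (F := fun b => gdot (delta_mx 0 i) b)); last first.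
  by move=> *; rewrite gdot_comb_r.
apply: eq_bigr => j _; congr (_ * _).
by have := gramE i j; rewrite mxE !coord_tvecE gdot_delta.
Qed.

Hypothesis g_somewhere : forall x, M x -> exists phi u,
  [/\ Phi phi, D u, phi u = x &
      forall i j, gram D Phi g phi u i j = 1 + (i == j)%:R].

(** The transition maps are isometries for [gdot], so one chart around each
    point is enough. *)
Lemma gram_const phi u i j : Phi phi -> D u ->
  gram D Phi g phi u i j = 1 + (i == j)%:R.
Proof.
move=> Pphi Du; have [psi [v [Ppsi Dv vu gramE]]] := g_somewhere (chart_sub Pphi Du).
have psiu : (psi @` D) (phi u) by exists v.
rewrite mxE -{1}vu !coord_tvecE.
rewrite (metric_gram Ppsi Dv gramE) ?vu; try exact: tvec_of_tangent.
by rewrite !tvec_ofE// -!rowE gdot_jacobian.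
Qed.

Lemma metric_gdot phi u X Y : Phi phi -> D u ->
  tangent D Phi (phi u) X -> tangent D Phi (phi u) Y ->
  g (phi u) X Y = gdot (X phi) (Y phi).
Proof. by move=> Pphi Du; apply: metric_gram => // i j; exact: gram_const. Qed.

Lemma const_locally_affine (W : set 'rV[R]_n) (F : 'rV[R]_n -> R) (c : R) :
  open W -> (forall u, W u -> F u = c) -> locally_affine W F.
Proof.
move=> oW Fc u Wu; exists 0; have nW : \forall w \near u, W w by exact: open_nbhs_nbhs.
by apply: filterS nW => w Ww; rewrite mulmx0 mxE addr0 !Fc.
Qed.

Lemma hinged_riemannian : riemannian_metric M D Phi g.
Proof.
split=> //.
- move=> x X Y /covered[phi [u [Pphi Du <-]]] tX tY.
  by rewrite !(metric_gdot Pphi Du)// gdotC.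
- move=> x X /covered[phi [u [Pphi Du <-]]] tX X0.
  rewrite (metric_gdot Pphi Du)//; apply: gdot_gt0; apply/eqP => Xphi0; apply: X0.
  rewrite (tangentE Pphi Du tX) Xphi0; apply/funext => psi.
  by rewrite /tvec_of mul0mx if_same.
- move=> phi Pphi i j; apply: smooth_locally_affine.
  apply: (@const_locally_affine _ _ (1 + (i == j)%:R)); first exact: Bipyr_open.
  by move=> u Du; exact: gram_const.
Qed.

Lemma const_partial (F : 'rV[R]_n -> R) (c : R) i u :
  (forall w, D w -> F w = c) -> D u -> partial i F u = 0.
Proof.
move=> Fc Du; rewrite /partial.
have nD : \forall w \near u, F w = cst c w.
  have : \forall w \near u, D w by apply: open_nbhs_nbhs; split=> //; exact: Bipyr_open.
  by apply: filterS => w /Fc.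
by rewrite (near_eq_derive _ nD) derive_cst.
Qed.

Lemma hinged_flat : flat D Phi g.
Proof.
have christoffel0 phi (k i j : 'I_n) u : Phi phi -> D u ->
    christoffel D Phi g phi k i j u = 0.
  move=> Pphi Du; rewrite /christoffel big1 ?mulr0// => l _.
  have p0 a b c : partial a (fun w => gram D Phi g phi w b c) u = 0.
    by apply: (@const_partial _ (1 + (b == c)%:R)) => // w Dw; exact: gram_const.
  by rewrite !p0 addr0 subr0 mulr0.
move=> phi u Pphi Du l k i j; rewrite /curvature.
have p0 a b c d : partial a (christoffel D Phi g phi b c d) u = 0.
  by apply: (@const_partial _ 0) => // w Dw; exact: christoffel0.
rewrite !p0 subr0 add0r big1// => m _.
by rewrite !christoffel0// !mul0r subr0.
Qed.

End Metric.


(** * Ambient vectors *)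

Lemma near_chart_low h u : coord_sum u < 1 -> forall w : V, \forall t \near u,
  hinge_chart h t w = hinge_chart h u w + ((t - u) *m \col_i dir h false i w) 0 0.
Proof.
move=> u1 w; have nb : \forall t \near u, coord_sum t < 1.
  exact: (@coord_sum_continuous R n u [set r | r < 1]
    (open_nbhs_nbhs (conj (@open_lt _ 1) u1))).
apply: filterS nb => t t1; rewrite (chart_side _ _ (ltW u1 : side false u) (ltW t1)).
congr (_ + _); rewrite [RHS]mxE; apply: eq_bigr => i _; congr (_ * _).
by rewrite mxE.
Qed.

(** Around [z], the chart [psi] is [phi] after a transition map, so by the chain
    rule its derivative along a coordinate vector of [phi] is that of [phi]. *)
Lemma ambient_coord phi h u i psi z (w : V) : phi = hinge_chart h ->
  Phi phi -> Phi psi -> D u -> coord_sum u < 1 -> D z -> psi z = phi u ->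
  is_derive z (coord_tvec D Phi phi u i psi) (fun t => psi t w : R) (dir h false i w).
Proof.
move=> phiE Pphi Ppsi Du u1 Dz zu.
have psiu : (psi @` D) (phi u) by exists z.
have phiz : (phi @` D) (psi z) by exists u.
have trz : tr psi phi z = u by apply: transition_unique.
pose c := 'J (tr psi phi) z *m \col_i dir h false i w.
have n1 := overlap_near Ppsi Pphi Dz phiz.
have n2 := jacobian_near Ppsi Pphi Dz phiz.
have trc := near_affine_continuous n2.
have n3 : \forall t \near z, hinge_chart h (tr psi phi t) w =
    hinge_chart h u w + ((tr psi phi t - u) *m \col_i dir h false i w) 0 0.
  have := near_chart_low h u1 w; rewrite -trz => nu.
  exact: (trc _ nu).
have n4 : \forall t \near z, psi t w = psi z w + ((t - z) *m c) 0 0.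
  apply: filterS3 n1 n2 n3 => t [_ phit] e2 e3.
  have [_ eq1] := transitionK Pphi phit.
  have tE : hinge_chart h (tr psi phi t) = psi t by rewrite -phiE.
  have zE : psi z = hinge_chart h u by rewrite -phiE.
  rewrite -tE zE e3 e2 trz /c mulmxA; congr (_ + (_ *m _) _ _).
  by rewrite addrC addKr.
have [d dE] := near_affine_differentiable n4.
apply: DeriveDef; first exact: diff_derivable.
rewrite dE coord_tvecE (tvec_ofE _ Ppsi psiu) /c mulmxA -(mulmxA (delta_mx 0 i)).
have JJ : 'J (tr phi psi) u *m 'J (tr psi phi) z = 1%:M.
  have phiu : (phi @` D) (phi u) by exists u.
  have := jacobian_comp Pphi Ppsi Pphi Du psiu phiu.
  by rewrite (jacobian_id Pphi Du) (transition_unique Ppsi Dz zu).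
by rewrite JJ mulmx1 -rowE !mxE.
Qed.

Lemma ambient_unique h u (a : 'rV[R]_n) i : coord_sum u < 1 ->
  (forall w : V, is_derive u a (fun t => hinge_chart h t w : R) (dir h false i w)) ->
  a = delta_mx 0 i.
Proof.
move=> u1 da; apply/rowP => j.
have [d dE] := near_affine_differentiable (near_chart_low h u1 (edge h j)).
have := @derive_val _ _ _ _ _ _ _ (da (edge h j)).
rewrite dE dir_edge subr0 => e.
rewrite [RHS]mxE eqxx andTb eq_sym -e [RHS]mxE (bigD1 j)// mxE dir_edge eqxx subr0 mulr1.
rewrite big1 => [|l /andP[_ lj]]; first by rewrite /= addr0.
by rewrite mxE dir_edge (negPf lj) subr0 mulr0.
Qed.

(** The dummy value [0] is only taken outside [M]. *)
Definition some_chart x : 'rV[R]_n -> E :=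
  xget (fun=> 0) [set phi | Phi phi /\ (phi @` D) x].

Definition chart_metric x (X Y : @tvec R n E) : R :=
  gdot (X (some_chart x)) (Y (some_chart x)).

Lemma some_chartP x : M x -> Phi (some_chart x) /\ (some_chart x @` D) x.
Proof.
move=> /covered[phi [u [Pphi Du <-]]].
apply: (@xgetPex _ _ [set psi | Phi psi /\ (psi @` D) (phi u)]).
by exists phi; split=> //; exists u.
Qed.

Lemma chart_metric_bilinear x : M x -> bilinear_at D Phi chart_metric x.
Proof.
move=> Mx; split=> c X Y Z _ _ _; first exact: gdot_comb.
exact: gdot_comb_r.
Qed.

Lemma chart_metric_somewhere x : M x -> exists phi u,
  [/\ Phi phi, D u, phi u = x &
      forall i j, gram D Phi chart_metric phi u i j = 1 + (i == j)%:R].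
Proof.
move=> Mx; have [Pphi [u Du ux]] := some_chartP Mx.
exists (some_chart x), u; split=> // i j.
rewrite mxE /chart_metric ux !coord_tvecE !tvec_of_self//; exact: gdot_delta.
Qed.

End HingedSpace.

(** * Hinges of the serenation *)

Section Cone.
Context {V : Type} {n : nat}.

Definition cone (e : 'I_n -> V) (p : V) : 'I_n.+1 -> V :=
  fun k => if unlift ord0 k is Some i then e i else p.

Lemma cone_inj e p : injective e -> ~ range e p -> injective (cone e p).
Proof.
move=> eI ep i j; rewrite /cone.
case: unliftP => [i' ->|->]; case: unliftP => [j' ->|->] //.
- by move=> /eI ->.
- by move=> ei; case: ep; exists i'.
- by move=> ej; case: ep; exists j'.
Qed.

Lemma range_cone e p : range (cone e p) = range e `|` [set p].
Proof.
apply/seteqP; split=> w; rewrite /cone.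
  by move=> [k _ <-]; case: unliftP => [i _|_]; [left; exists i|right].
move=> [[i _ <-]|->]; first by exists (lift ord0 i) => //; rewrite liftK.
by exists ord0 => //; rewrite unlift_none.
Qed.

Lemma sum_cone (R : realType) (e : 'I_n -> V) p (y : V -> R) :
  \sum_k y (cone e p k) = \sum_i y (e i) + y p.
Proof.
rewrite big_ord_recl addrC /cone unlift_none; congr (_ + _).
by apply: eq_bigr => i _; rewrite liftK.
Qed.

Lemma card_range (m : nat) (t : 'I_m -> V) : injective t -> (range t #= `I_m)%card.
Proof.
move=> tI; rewrite (card_eqr card_II).
by apply: inj_card_eq => i j _ _; exact: tI.
Qed.

Lemma card_enum (F : set V) (m : nat) : (F #= `I_m)%card ->
  exists2 t : 'I_m -> V, injective t & range t = F.
Proof.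
rewrite (card_eqr card_II) card_eq_sym => /card_bijP[g [g' gK g'K]].
exists (fun i : 'I_m => set_val (g (to_setT i))).
  by move=> i j /val_inj/(can_inj gK)/(congr1 set_val).
apply/seteqP; split=> w; first by move=> [i _ <-]; exact: set_valP.
move=> Fw; pose v : F := SigSub (mem_set Fw); exists (set_val (g' v)) => //.
have -> : to_setT (set_val (g' v)) = g' v by exact: val_inj.
by rewrite g'K.
Qed.

End Cone.

Section ConeHinge.
Context {R : realType} {V : Type} {n : nat}.
Local Notation E := (pw_space R V).

Lemma cone_hinge_open (h : hinge V n) b (y : E) :
  on_simplex (cone (edge h) (apex h b)) y ->
  (forall i, 0 < (y (edge h i) : R)) -> 0 <= (y (apex h b) : R) -> hinge_open h y.
Proof.
move=> [y0 y1] ypos yb; rewrite range_cone in y0; rewrite sum_cone in y1.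
have nb : y (apex h (~~ b)) = 0.
  by apply: y0 => -[|/esym/apexK//]; exact: apex_out.
split=> //.
- by move=> c; case: (eqVneq c b) => [->//|]; case: c b nb {yb y0 y1} => [] [] //= ->.
- by case: b nb {yb y0 y1} => /= ->; rewrite ?mul0r ?mulr0.
- move=> w we wa; apply: y0 => -[|wb]; [exact: we|exact: (wa b)].
- by case: b nb y1 {yb y0} => /= ->; rewrite ?addr0 // addrAC addr0.
Qed.

Lemma open_cone_hinge (h : hinge V n) (x : E) : (0 < n)%N ->
  OCvx (delta @` range (cone (edge h) (apex h false))) x ->
  hinge_open h x /\ coord_sum (hinge_coord h x) < 1.
Proof.
move=> n_gt0; rewrite OCvx_simplex; last first.
  by apply: cone_inj; [exact: edge_inj|exact: apex_out].
move=> [xs xpos].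
have xf : 0 < (x (apex h false) : R).
  by have := xpos ord0; rewrite /cone unlift_none.
have xe i : 0 < (x (edge h i) : R).
  by have := xpos (lift ord0 i); rewrite /cone liftK.
have ho := cone_hinge_open xs xe (ltW xf); split=> //.
have [_ _ /eqP xx _ x1] := ho; move: xx; rewrite mulf_eq0 gt_eqF//= => /eqP x0.
by rewrite coord_sum_hinge// x0; move: x1; rewrite x0; lra.
Qed.

End ConeHinge.

Section FaceHinge.
Context {R : realType} {n : nat} {A : Type} {f : ('I_n -> A) -> A}.
Hypothesis n_gt0 : (0 < n)%N.
Local Notation V := (vertex f).
Local Notation E := (pw_space R V).

Lemma OSerP (x : E) : OSer R f x <-> exists gamma : set V,
  [/\ face gamma, (gamma #= `I_n)%card \/ (gamma #= `I_n.+1)%card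
    & OCvx (delta @` gamma) x].
Proof. by []. Qed.

(** A face with at least [n] vertices that contains the facet of [h] is this
    facet or one of the two simplices of [h]; a point of the open serenation
    with positive coordinates on the facet lies in the interior of such a face. *)
Lemma face_hinge (h : hinge V n) :
  (forall a, NCT f a -> exists2 t : 'I_n.+1 -> V, injective t & range t = top_face a) ->
  (forall b, exists2 a, NCT f a & top_face a = range (edge h) `|` [set apex h b]) ->
  (forall a, NCT f a -> range (edge h) `<=` top_face a ->
     exists b, top_face a = range (edge h) `|` [set apex h b]) ->
  hinge_of (OSer R f) h.
Proof.
move=> topE tops unique; have eI := @edge_inj _ _ h.
have cI b := cone_inj eI (@apex_out _ _ h b).
apply/seteqP; split=> y.
  move=> [/OSerP[F [[a Na Fa] Fn yF]] ypos].
  have cone_open b : on_simplex (cone (edge h) (apex h b)) y ->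
      0 <= (y (apex h b) : R) -> hinge_open h y.
    by move=> yt; exact: cone_hinge_open yt ypos.
  case: Fn => /card_enum[t tI tF].
    have te : range t = range (edge h).
      apply: inj_range_eq => // i; rewrite tF; move: yF; rewrite -tF OCvx_simplex//.
      move=> [[y0 _] _]; apply: contrapT => /y0 yi.
      by have := ypos i; rewrite yi ltxx.
    move: yF; rewrite -tF te OCvx_simplex// => -[[y0 y1] _].
    have a0 b : y (apex h b) = 0 by apply: y0; exact: apex_out.
    apply: (cone_open false); last by rewrite a0.
    split; last by rewrite sum_cone y1 a0 addr0.
    by rewrite range_cone => w wc; apply: y0 => we; apply: wc; left.
  have [s sI sa] := topE a Na.
  have st : range s = range t.
    by apply: inj_range_eq => // i; rewrite sa; apply: Fa; rewrite -tF; exists i.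
  have ea : range (edge h) `<=` top_face a.
    move=> _ [i _ <-]; rewrite -sa st tF; move: yF; rewrite -tF OCvx_simplex//.
    move=> [[y0 _] _]; apply: contrapT => /y0 yi.
    by have := ypos i; rewrite yi ltxx.
  have [b ab] := unique a Na ea; apply: (cone_open b).
    move: yF; rewrite -tF -st sa ab -range_cone OCvx_simplex// => -[//].
  move: yF; rewrite -tF -st sa ab -range_cone OCvx_simplex// => -[_ /(_ ord0)].
  by rewrite /cone unlift_none => /ltW.
move=> [ypos ynn y00 y0 y1]; split=> //; apply/OSerP.
have [b yb] : exists b, y (apex h (~~ b)) = 0.
  by move/eqP: y00; rewrite mulf_eq0 => /orP[]/eqP ?; [exists true|exists false].
have [a Na aE] := tops b.
have s1 : \sum_i (y (edge h i) : R) + y (apex h b) = 1.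
  by case: b yb {aE} => /= yb; move: y1; rewrite yb ?addr0// addrAC addr0.
have z0 w : ~ range (edge h) w -> w <> apex h b -> y w = 0.
  move=> we wb; case: (pselect (w = apex h (~~ b))) => [->//|wnb].
  apply: y0 => // c; case: (eqVneq c b) => [->//|].
  by case: c b wb wnb {yb aE s1} => [] [].
have [yb0|yb0] := eqVneq (y (apex h b) : R) 0.
  exists (range (edge h)); split.
  - by exists a => //; rewrite aE; left.
  - by left; exact: card_range.
  - rewrite OCvx_simplex//; split=> //; split; last by rewrite -s1 yb0 addr0.
    move=> w we; case: (pselect (w = apex h b)) => [->//|]; exact: z0.
exists (range (cone (edge h) (apex h b))); split.
- by exists a => //; rewrite aE range_cone.
- by right; exact: card_range.
- rewrite OCvx_simplex//; split.
    split; last by rewrite sum_cone.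
    by rewrite range_cone => w wc; apply: z0 => we; apply: wc; [left|right].
  move=> k; rewrite /cone; case: unliftP => [i _|_]; first exact: ypos.
  by rewrite lt_def yb0 ynn.
Qed.

End FaceHinge.

(** * Tuples that do not commute *)

Section NonCommuting.
Context {n : nat} {A : Type} {f : ('I_n -> A) -> A}.
Hypotheses (fq : quasigroup f) (falt : alternating_op f).
Implicit Types (a b : 'I_n -> A) (s t : 'S_n).

Lemma comp_permM a s t : a \o (t * s)%g = (a \o s) \o t.
Proof. by apply/funext => i; rewrite /= permM. Qed.

Lemma comp_perm1 a : a \o (1 : 'S_n)%g = a.
Proof. by apply/funext => i; rewrite /= perm1. Qed.

Lemma f_odd a s t : odd_perm s -> odd_perm t -> f (a \o s) = f (a \o t).
Proof.
move=> os ot; rewrite (falt (a \o s) (s := (t * s^-1)%g)); last first.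
  by rewrite odd_permM odd_permV os ot.
by rewrite -comp_permM mulgKV.
Qed.

(** By [f_odd], one odd permutation that fixes the value of [f] at [a] forces all
    of them to do so. *)
Lemma NCT_odd a s : NCT f a -> odd_perm s -> f (a \o s) <> f a.
Proof.
move=> Na os e; apply: Na => t; case: (boolP (odd_perm t)) => ot; last exact: falt.
by rewrite -e; exact: f_odd.
Qed.

(** A repetition makes an odd permutation act trivially. *)
Lemma NCT_inj a : NCT f a -> injective a.
Proof.
move=> Na i j aij; apply: contrapT => ij; apply: (NCT_odd (s := tperm i j) Na).
  by rewrite odd_tperm; apply/eqP.
congr f; apply/funext => k /=; case: tpermP => [->|->|] //.
Qed.

Lemma NCT_perm a s : NCT f a -> NCT f (a \o s).
Proof.
move=> Na ca; apply: Na => t.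
have e (r : 'S_n) : f (a \o s) = f (a \o r).
  by rewrite (ca (r * s^-1)%g) -comp_permM mulgKV.
by rewrite -e -[in LHS](comp_perm1 a) -e.
Qed.

Definition upd a (i : 'I_n) (z : A) : 'I_n -> A := [eta a with i |-> z].

Lemma upd_same a i z : upd a i z i = z.
Proof. by rewrite /upd /= eqxx. Qed.

Lemma upd_neq a i z j : j != i -> upd a i z j = a j.
Proof. by rewrite /upd /= => /negPf ->. Qed.

Lemma upd_id a i : upd a i (a i) = a.
Proof. by apply/funext => j; rewrite /upd /=; case: eqVneq => [->|]. Qed.

Lemma upd_solve a i y : exists z, f (upd a i z) = y.
Proof. by have [z [zy _]] := fq i a y; exists z. Qed.

Lemma upd_inj a i z z' : f (upd a i z) = f (upd a i z') -> z = z'.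
Proof. by have [w [_ wU]] := fq i a (f (upd a i z)) => e; rewrite -(wU z)// -(wU z'). Qed.

Lemma upd_tperm a i j z : i != j ->
  upd a i z \o tperm i j = upd (a \o tperm i j) j z.
Proof.
move=> ij; apply/funext => l; rewrite /upd /=.
case: tpermP => [->|->|/eqP li /eqP lj]; first by rewrite eq_sym (negPf ij).
  by rewrite !eqxx.
by rewrite (negPf li) (negPf lj).
Qed.

Lemma NCT_distinct a : NCT f a -> exists i j : 'I_n, i != j.
Proof.
move=> Na; apply: contrapT => no; apply: Na => s; congr f; apply/funext => i /=.
congr a; apply: contrapT => si; apply: no; exists i, (s i); exact/eqP.
Qed.

Section Last.
Variables (k k' : 'I_n).
Hypotheses (kn : k.+1 = n) (k'n : k'.+2 = n).

Let kk' : k != k'.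
Proof.
apply/eqP => e; have := etrans kn (esym k'n); rewrite e => /eqP.
by rewrite eqSS ltn_eqF.
Qed.

Lemma shift_insertE a z : shift_insert a z = upd a k z \o tperm k k'.
Proof.
apply/funext => i; rewrite /shift_insert /=.
have -> : (i.+2 == n) = (i == k').
  by apply/eqP/eqP => [e|->//]; apply/val_inj/succn_inj/succn_inj; rewrite k'n.
have -> : (i.+1 == n) = (i == k).
  by apply/eqP/eqP => [e|->//]; apply/val_inj/succn_inj; rewrite kn.
case: tpermP => [->|->|/eqP /negPf ik /eqP /negPf ik'].
- rewrite (negPf kk') eqxx upd_neq 1?eq_sym//; congr a; apply: val_inj => /=.
  have -> : (k : nat) = k'.+1 by apply: succn_inj; rewrite kn k'n.
  by rewrite addSn /= modnDr modn_small.
- by rewrite eqxx upd_same.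
- by rewrite ik' ik upd_neq ?ik.
Qed.

Lemma opposite_solve a : exists z, opposite_entry f a z.
Proof.
have [z zE] := upd_solve (a \o tperm k k') k' (f a).
by exists z; rewrite /opposite_entry shift_insertE upd_tperm.
Qed.

Variables (a : 'I_n -> A) (z : A).
Hypotheses (Na : NCT f a) (az : opposite_entry f a z).

Let odd_kk' : odd_perm (tperm k k').
Proof. by rewrite odd_tperm. Qed.

Lemma opposite_NCT : NCT f (upd a k z).
Proof.
move=> cz; have e : f (upd a k z) = f (upd a k (a k)).
  by rewrite upd_id -az shift_insertE; exact: cz.
have zk := upd_inj e; apply: (NCT_odd Na odd_kk').
by rewrite -[in RHS]az shift_insertE zk upd_id.
Qed.

Lemma opposite_neq i : z <> a i.
Proof.
case: (eqVneq i k) => [->|ik] zi.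
  apply: (NCT_odd Na odd_kk').
  by rewrite -[in RHS]az shift_insertE zi upd_id.
have := @NCT_inj _ opposite_NCT i k; rewrite upd_same (upd_neq _ _ ik).
move=> /(_ (esym zi)) ek.
by rewrite ek eqxx in ik.
Qed.

(** The vertex [z] is the apex opposite to [a k]: together with [opposite_neq],
    this says that the output facet of [a] lies in exactly two top simplices. *)
Lemma opposite_unique w : opposite_entry f a w -> w = z.
Proof.
move: az; rewrite /opposite_entry !shift_insertE !upd_tperm// => <-; exact: upd_inj.
Qed.

End Last.

(** A tuple whose top simplex contains the output facet of [a] can be reordered
    like [a], after which unique solvability determines the remaining entry. *)
Lemma perm_off a b k : injective a -> (forall i, i != k -> exists j, a i = b j) ->
  exists s : 'S_n, b \o s = upd a k (b (s k)).
Proof.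
move=> aI ab.
have [r rP] : exists r : 'I_n -> 'I_n, forall i, i != k -> a i = b (r i).
  pose r i := if pselect (exists j, a i = b j) is left e then projT1 (cid e) else i.
  exists r => i /ab e; rewrite /r; case: pselect => // e'; by case: cid.
have rI i j : i != k -> j != k -> r i = r j -> i = j.
  by move=> ik jk e; apply: aI; rewrite rP// e -rP.
have [j0 j0P] : exists j0, forall i, i != k -> r i != j0.
  pose S := [set r i | i in [set~ k]]%SET.
  have cS : (#|S| < n)%N.
    apply: leq_ltn_trans (leq_imset_card _ _) _.
    by rewrite cardsC1 card_ord ltn_predL (leq_ltn_trans _ (ltn_ord k)).
  have /existsP[j0 j0S] : [exists j0, j0 \notin S].
    rewrite -negb_forall; apply/negP => /forallP allS.
    move: cS; rewrite (_ : S = [set: 'I_n]%SET) ?cardsT ?card_ord ?ltnn//.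
    by apply/setP => j; rewrite allS inE.
  exists j0 => i ik; apply: contraNneq j0S => <-.
  by apply/imsetP; exists i => //; rewrite !inE.
pose q i := if i == k then j0 else r i.
have qI : injective q.
  move=> i j; rewrite /q; case: eqVneq => [->|ik]; case: eqVneq => [->|jk] //.
  - by move=> e; have := j0P _ jk; rewrite e eqxx.
  - by move=> e; have := j0P _ ik; rewrite e eqxx.
  - exact: rI.
exists (perm qI); apply/funext => i /=; rewrite !permE /q eqxx /upd /=.
by case: eqVneq => // ik; rewrite rP.
Qed.

End NonCommuting.

(** * Charts of the serenation are hinge charts *)

Section SerenationCharts.
Context {R : realType} {n : nat} {A : Type} {f : ('I_n -> A) -> A}.
Hypotheses (n_gt0 : (0 < n)%N) (fq : quasigroup f) (falt : alternating_op f).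
Local Notation V := (vertex f).
Local Notation E := (pw_space R V).
Implicit Types (a b : 'I_n -> A) (v : V).

Definition label v : A + A :=
  match v with inl x => inl (\val x) | inr y => inr (\val y) end.

Lemma label_inj : injective label.
Proof. by move=> [x|x] [y|y] //= [] /val_inj ->. Qed.

Lemma lower_vertex a i : NCT f a -> exists v, label v = inl (a i).
Proof.
move=> Na; have ai : In f (a i) by exists a => //; exists i.
by exists (inl (SigSub (mem_set ai))).
Qed.

Lemma upper_vertex a : NCT f a -> exists v, label v = inr (f a).
Proof.
move=> Na; have fa : Out f (f a) by exists a.
by exists (inr (SigSub (mem_set fa))).
Qed.

Lemma lower_vecE x v : label v = inl x -> lower_vec R f x = delta v.
Proof.
case: v => [y [<-]|//]; apply/funext => -[w|w]; rewrite /lower_vec /delta.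
  congr ((nat_of_bool _)%:R); apply: asbool_equiv_eq.
  by split=> [/val_inj ->|[->]].
by rewrite asboolF.
Qed.

Lemma upper_vecE x v : label v = inr x -> upper_vec R f x = delta v.
Proof.
case: v => [//|y [<-]]; apply/funext => -[w|w]; rewrite /upper_vec /delta.
  by rewrite asboolF.
congr ((nat_of_bool _)%:R); apply: asbool_equiv_eq.
  by split=> [/val_inj ->|[->]].
Qed.

Lemma top_faceP a v :
  top_face a v <-> (exists i, label v = inl (a i)) \/ label v = inr (f a).
Proof.
split; case: v => [x|y] /=.
- by move=> [i ->]; left; exists i.
- by move=> ->; right.
- by move=> [[i [->]]|//]; exists i.
- by move=> [[i //]|[->]].
Qed.

Lemma bipyr_chartE (h : hinge V n) (e : 'I_n -> E) (p q : E) :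
  (forall i, e i = delta (edge h i)) -> p = delta (apex h false) ->
  q = delta (apex h true) -> bipyr_chart e p q = hinge_chart h.
Proof.
move=> eE -> ->; apply/funext => u; apply/funext => w.
have n0 : (n%:R : R) != 0 by rewrite pnatr_eq0 -lt0n.
rewrite /bipyr_chart /hinge_chart; case: ifPn => [u1|].
  have -> : (\sum_i u 0 i *: e i + (1 - coord_sum u) *: delta (apex h false)) w =
      \sum_i u 0 i * e i w + (1 - coord_sum u) * delta (apex h false) w :> R.
    by rewrite -[LHS]/(_ + _) eval_comb.
  rewrite height_low// mul0r !addr0 mulr0.
  by congr (_ + _); apply: eq_bigr => i _; rewrite eE subr0.
rewrite -ltNge => /ltW u1.
have -> : (\sum_i reflected u i *: e i + (coord_sum u - 1) *: delta (apex h true)) w =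
    \sum_i reflected u i * e i w + (coord_sum u - 1) * delta (apex h true) w :> R.
  by rewrite -[LHS]/(_ + _) eval_comb.
rewrite height_high// (_ : 1 - _ + _ = 0) ?mul0r ?addr0; last by ring.
congr (_ + _); apply: eq_bigr => i _; rewrite eE; congr (_ * _).
rewrite /reflected /coord_sum [in RHS](bigD1 i)//=.
by field.
Qed.

Lemma top_face_eq (e : 'I_n -> V) p a :
  (forall l, (exists i, l = inl (a i)) \/ l = inr (f a) <->
             (exists i, l = label (e i)) \/ l = label p) ->
  top_face a = range e `|` [set p].
Proof.
move=> lE; apply/seteqP; split=> v; rewrite top_faceP lE.
  by move=> [[i /label_inj ->]|/label_inj ->]; [left; exists i|right].
by move=> [[i _ <-]|->]; [left; exists i|right].
Qed.

Lemma top_face_enum a : NCT f a ->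
  exists2 t : 'I_n.+1 -> V, injective t & range t = top_face a.
Proof.
move=> Na; have [p pE] := upper_vertex Na.
pose e i := projT1 (cid (lower_vertex i Na)).
have eE i : label (e i) = inl (a i) by rewrite /e; case: cid.
exists (cone e p).
  apply: cone_inj => [i j /(congr1 label)|[i _ /(congr1 label)]]; rewrite !eE ?pE//.
  by move=> [/(NCT_inj falt Na)].
rewrite range_cone; apply/esym/top_face_eq => l.
by split=> -[[i ->]|->]; [left|right|left|right] => //; exists i; rewrite eE.
Qed.

(** All tuples with the entries of [a] are permutations of [a]; the even ones
    have the output [f a], the odd ones the output of [a] with two entries
    swapped. *)
Lemma in_hinge a (i j : 'I_n) : NCT f a -> i != j -> exists h : hinge V n,
  [/\ hinge_of (OSer R f) h, in_chart R f a (a \o tperm i j) = hinge_chart h,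
      forall l, label (edge h l) = inl (a l) & label (apex h false) = inr (f a)].
Proof.
move=> Na ij; have odd_ij : odd_perm (tperm i j) by rewrite odd_tperm.
have Na' := NCT_perm (s := tperm i j) Na; set a' := a \o _ in Na' *.
pose e l := projT1 (cid (lower_vertex l Na)).
have eE l : label (e l) = inl (a l) by rewrite /e; case: cid.
have [p pE] := upper_vertex Na; have [q qE] := upper_vertex Na'.
have eI : injective e.
  by move=> l m /(congr1 label); rewrite !eE => -[/(NCT_inj falt Na)].
pose ap (c : bool) := if c then q else p.
have apE (c : bool) : label (ap c) = inr (f (if c then a' else a)) by case: c.
have ap_neq : ap false <> ap true.
  by move=> /(congr1 label); rewrite !apE => -[/esym]; exact: (NCT_odd falt Na odd_ij).
have ap_out (c : bool) : ~ range e (ap c).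
  by move=> [l _ /(congr1 label)]; rewrite eE apE.
pose h := Hinge eI ap_neq ap_out.
exists h; split=> //; last 1 first.
- apply: bipyr_chartE => [l||]; first exact: lower_vecE.
    exact: upper_vecE.
  exact: upper_vecE.
have faceE b (c : bool) : (forall x, (exists l, x = b l) <-> exists l, x = a l) ->
    f b = f (if c then a' else a) -> top_face b = range e `|` [set ap c].
  move=> ab fb; apply: top_face_eq => l; rewrite fb -apE.
  split=> -[[m ->]|->]; [|by right| |by right]; left.
    have [m' ->] : exists m', b m = a m' by apply/ab; exists m.
    by exists m'; rewrite eE.
  have [m' em] : exists m', a m = b m' by apply/ab; exists m.
  by exists m'; rewrite eE em.
apply: face_hinge => //; first exact: top_face_enum.
  move=> c; exists (if c then a' else a); first by case: c.
  apply: faceE => // x; case: c => //.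
  split=> -[l ->]; first by exists (tperm i j l).
  by exists (tperm i j l); rewrite /a' /= tpermK.
move=> b Nb sub.
have ab l : exists m, a l = b m.
  have /top_faceP : top_face b (e l) by apply: sub; exists l.
  by rewrite eE => -[[m [->]]|//]; exists m.
have [s sE] : exists s : 'S_n, b \o s = a.
  have [s sE] := perm_off (k := i) (NCT_inj falt Na) (fun l _ => ab l).
  exists s; rewrite sE; suff -> : b (s i) = a i by exact: upd_id.
  have [m am] := ab i; rewrite am -[m](permKV s) -/((b \o s) _) sE.
  have [->|mi] := eqVneq (s^-1%g m) i; first by rewrite upd_same.
  have := am; rewrite -[m](permKV s) -/((b \o s) _) sE (upd_neq _ _ mi).
  by move=> /(NCT_inj falt Na) im; rewrite -im eqxx in mi.
have bE : b = a \o (s^-1)%g by apply/funext => l; rewrite -sE /= permKV.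
exists (odd_perm s); apply: faceE.
  move=> x; split=> -[l ->]; first by exists (s^-1%g l); rewrite bE.
  by exists (s l); rewrite -sE.
rewrite bE; case: (boolP (odd_perm s)) => os.
  by apply: f_odd => //; rewrite odd_permV.
by rewrite -falt// odd_permV.
Qed.


Lemma penultimate a (k : 'I_n) : NCT f a -> k.+1 = n -> exists k' : 'I_n, k'.+2 = n.
Proof.
move=> Na kn; have [i [j ij]] := NCT_distinct Na.
have k_gt0 : (0 < k)%N.
  rewrite lt0n; apply: contraNneq ij => k0; apply/eqP/val_inj.
  have i0 (l : 'I_n) : (l : nat) = 0%N.
    by apply/eqP; rewrite -leqn0 -ltnS -k0 kn.
  by rewrite /= !i0.
by exists (Ordinal (leq_ltn_trans (leq_pred k) (ltn_ord k))); rewrite /= prednK.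
Qed.

Lemma out_facetE a (k : 'I_n) l : k.+1 = n ->
  out_facet R f a l = if l == k then upper_vec R f (f a) else lower_vec R f (a l).
Proof.
move=> kn; rewrite /out_facet; congr (if _ then _ else _).
by apply/eqP/eqP => [le|->//]; apply/val_inj/succn_inj; rewrite kn.
Qed.

(** A tuple whose top simplex contains the output facet of [a] is, up to an even
    permutation, [a_1, .., a_(n-1), w] or [a_1, .., a_(n-2), w, a_(n-1)], and [w]
    is determined by the value [f a]. *)
Lemma out_hinge a (k : 'I_n) z : NCT f a -> k.+1 = n -> opposite_entry f a z ->
  exists h : hinge V n,
  [/\ hinge_of (OSer R f) h, out_chart R f a (a k) z = hinge_chart h &
      forall l, label (edge h l) = if l == k then inr (f a) else inl (a l)].
Proof.
move=> Na kn az.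
have [k' k'n] := penultimate Na kn.
have kk' : k != k'.
  apply/eqP => e; have := etrans kn (esym k'n); rewrite e => /eqP.
  by rewrite eqSS ltn_eqF.
have Nz := opposite_NCT fq falt kn k'n Na az.
have z_neq := opposite_neq fq falt kn k'n Na az.
have [t tE] := upper_vertex Na.
pose e l := if l == k then t else projT1 (cid (lower_vertex l Na)).
have eE l : label (e l) = if l == k then inr (f a) else inl (a l).
  by rewrite /e; case: eqP => // _; case: cid.
have [p pE] := lower_vertex k Na; have [q] := lower_vertex k Nz.
rewrite upd_same => qE.
have eI : injective e.
  move=> l m /(congr1 label); rewrite !eE.
  by case: eqVneq => [->|_]; case: eqVneq => [->|_] // -[/(NCT_inj falt Na)].
(* The last entry of the tuple whose top simplex is the cone with apex [ap c]. *)
pose new (c : bool) := if c then z else a k.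
pose ap (c : bool) := if c then q else p.
have apE c : label (ap c) = inl (new c) by case: c.
have ap_neq : ap false <> ap true.
  by move=> /(congr1 label); rewrite !apE => -[/esym]; exact: z_neq.
have ap_out c : ~ range e (ap c).
  move=> [l _ /(congr1 label)]; rewrite eE apE; case: eqVneq => // lk [].
  case: c => /= [/esym|/(NCT_inj falt Na) el]; first exact: z_neq.
  by rewrite el eqxx in lk.
pose h := Hinge eI ap_neq ap_out.
exists h; split=> //; last first.
  apply: bipyr_chartE => [l||]; [|exact: lower_vecE|exact: lower_vecE].
  rewrite (out_facetE a l kn).
  have := eE l; case: eqP => _ el; [exact: upper_vecE|exact: lower_vecE].
have faceE b (c : bool) :
    (forall x, (exists l, x = b l) <-> exists l, x = upd a k (new c) l) ->
    f b = f a -> top_face b = range e `|` [set ap c].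
  move=> ab fb; apply: top_face_eq => l; rewrite fb apE.
  split=> -[[m ->]|->].
  - have [m' ->] : exists m', b m = upd a k (new c) m' by apply/ab; exists m.
    have [->|mk] := eqVneq m' k; first by right; rewrite upd_same.
    by left; exists m'; rewrite eE (negPf mk) upd_neq.
  - by left; exists k; rewrite eE eqxx.
  - rewrite eE; case: eqVneq => mk; first by right.
    have [m' em] : exists m', upd a k (new c) m = b m' by apply/ab; exists m.
    by left; exists m'; rewrite -em upd_neq.
  - have [m' em] : exists m', upd a k (new c) k = b m' by apply/ab; exists k.
    by left; exists m'; rewrite -em upd_same.
apply: face_hinge => //; first exact: top_face_enum.
  case; last by exists a => //; apply: faceE => // x; rewrite /= upd_id.
  exists (upd a k z \o tperm k k'); first exact: NCT_perm.
  apply: faceE; last by rewrite -shift_insertE.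
  move=> x; split=> -[l ->]; first by exists (tperm k k' l).
  by exists (tperm k k' l); rewrite /= tpermK.
move=> b Nb sub.
have fb : f b = f a.
  have /top_faceP : top_face b (e k) by apply: sub; exists k.
  by rewrite eE eqxx => -[[m //]|[->]].
have ab l : l != k -> exists m, a l = b m.
  move=> lk; have /top_faceP : top_face b (e l) by apply: sub; exists l.
  by rewrite eE (negPf lk) => -[[m [->]]|//]; exists m.
have [s sE] := perm_off (NCT_inj falt Na) ab.
have entries c : b (s k) = new c -> forall x,
    (exists l, x = b l) <-> exists l, x = upd a k (new c) l.
  move=> bc x; rewrite -bc -sE; split=> -[l ->]; last by exists (s l).
  by exists (s^-1%g l); rewrite /= permKV.
exists (odd_perm s); apply: faceE => //; apply: entries.
case: (boolP (odd_perm s)) => os /=.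
  apply: (opposite_unique fq kn k'n az).
  rewrite /opposite_entry (shift_insertE kn k'n) -sE -comp_permM -falt//.
  by rewrite odd_permM odd_tperm kk' os.
by apply: (upd_inj fq (a := a) (i := k)); rewrite -sE -falt// upd_id.
Qed.

Lemma facet_split (F : set V) a : NCT f a -> F `<=` top_face a -> (F #= `I_n)%card ->
  exists2 v, top_face a v & F = top_face a `\ v.
Proof.
move=> Na Fa /card_enum[t tI tF]; have [s sI sa] := top_face_enum Na.
have st i : range s (t i) by rewrite sa; apply: Fa; rewrite -tF; exists i.
pose r i := projT1 (cid2 (st i)).
have rE i : s (r i) = t i by rewrite /r; case: cid2.
have rI : injective r by move=> i j ij; apply: tI; rewrite -!rE ij.
have [j0 j0P] : exists j0, forall i, r i != j0.
  have /existsP[j0 j0r] : [exists j, j \notin codom r].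
    rewrite -negb_forall; apply/negP => /forallP all_r.
    have : (#|codom r| = n.+1)%N.
      by rewrite -[RHS]card_ord; apply: eq_card => j; rewrite all_r.
    by rewrite card_codom// card_ord => /eqP; rewrite ltn_eqF.
  by exists j0 => i; apply: contraNneq j0r => <-; exact: codom_f.
exists (s j0); first by rewrite -sa; exists j0.
apply/seteqP; split=> v.
  move=> Fv; split; first exact: Fa.
  move: Fv; rewrite -tF => -[i _ <-] /= ti; have := j0P i; rewrite -rE in ti.
  by rewrite (sI _ _ ti) eqxx.
move=> [+ vj0]; rewrite -sa => -[j _ jv].
have [i ij] : exists i, r i = j.
  apply: contrapT => no; pose q k := if unlift ord0 k is Some i then r i else j.
  have qI : injective q.
    apply: cone_inj => // -[i _ e]; apply: no; by exists i.
  have /mapP[k _ kj0] : j0 \in codom q.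
    by rewrite codomE; apply: (inj_card_onto qI).
  move: kj0; rewrite /q; case: unliftP => [i _ e|_ e].
    by have := j0P i; rewrite -e eqxx.
  by apply: vj0; rewrite -jv e.
by rewrite -tF; exists i => //; rewrite -rE ij.
Qed.


(** The output charts of a tuple only show the facet without its last entry.
    The facet of [b] without [b i] is reached by moving [b i] to the last place
    [k] and, as this permutation is odd, replacing it there by the entry that
    restores the output [f b]. *)
Lemma rotate_NCT b (i k : 'I_n) w : NCT f b ->
  f (upd (b \o tperm i k) k w) = f b -> NCT f (upd (b \o tperm i k) k w).
Proof.
move=> Nb fw; have [ik|ik] := eqVneq i k.
  move: fw; rewrite ik tperm1 comp_perm1 -{2}(upd_id b k) => /(upd_inj fq) ->.
  by rewrite upd_id.
move=> cw; have bb : (b \o tperm i k) \o tperm k i = b.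
  by apply/funext => l; rewrite /= tpermC tpermK.
have := cw (tperm k i); rewrite upd_tperm 1?eq_sym// bb fw -[in LHS](upd_id b i).
move=> /(upd_inj fq) wE; apply: (NCT_odd falt Nb (s := tperm i k)).
  by rewrite odd_tperm.
have <- : upd (b \o tperm i k) k w = b \o tperm i k.
  by rewrite -[RHS](upd_id _ k) /= tpermR wE.
exact: fw.
Qed.

Lemma range_delta (h : hinge V n) (e : 'I_n -> E) :
  (forall i, e i = delta (edge h i)) -> range e = delta @` range (edge h).
Proof.
move=> eE; apply/seteqP; split=> x.
  by move=> [i _ <-]; exists (edge h i); [exists i|rewrite eE].
by move=> [_ [i _ <-] <-]; exists i.
Qed.

Lemma range_cone_label (h : hinge V n) a :
  (forall l, label (edge h l) = inl (a l)) -> label (apex h false) = inr (f a) ->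
  range (lower_vec R f \o a) `|` [set upper_vec R f (f a)] =
  delta @` range (cone (edge h) (apex h false)).
Proof.
move=> hl ha; rewrite range_cone image_setU image_set1 (upper_vecE ha).
by rewrite (@range_delta h)// => i; exact: lower_vecE.
Qed.

Lemma edge_open (h : hinge V n) x : hinge_of (OSer R f) h -> OSer R f x ->
  OCvx (delta @` range (edge h)) x -> hinge_open h x.
Proof.
move=> hM Mx; rewrite OCvx_simplex; last exact: edge_inj.
by move=> [_ xpos]; exact: hinge_ofP hM Mx xpos.
Qed.

(** The three alternatives match the three rules of the standard metric: the
    interior of a top simplex, and the two kinds of facets. *)
Lemma OSer_cover (x : E) : OSer R f x -> exists a phi (h : hinge V n),
  [/\ NCT f a, hinge_of (OSer R f) h, hinge_open h x, phi = hinge_chart h &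
  [\/ [/\ is_in_chart R f a phi, coord_sum (hinge_coord h x) < 1,
          OCvx (range (lower_vec R f \o a) `|` [set upper_vec R f (f a)]) x,
          forall l, label (edge h l) = inl (a l) & label (apex h false) = inr (f a)],
      is_in_chart R f a phi /\ OCvx (range (lower_vec R f \o a)) x |
      is_out_chart R f a phi /\ OCvx (range (out_facet R f a)) x]].
Proof.
move=> Mx; have /OSerP[F [[b Nb Fb] Fn xF]] := Mx.
have [i0 [j0 ij0]] := NCT_distinct Nb.
have [h [hM hE hl ha]] := in_hinge Nb ij0.
have inb : is_in_chart R f b (in_chart R f b (b \o tperm i0 j0)) by exists i0, j0.
case: Fn => Fn; last first.
  have topE : F = range (cone (edge h) (apex h false)).
    rewrite range_cone -(@top_face_eq _ _ b); last first.
      move=> l; split=> -[[i ->]|->]; [left|right|left|right]; rewrite ?ha//.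
        by exists i; rewrite hl.
      by exists i; rewrite hl.
    have [t tI tF] := card_enum Fn; have [s sI sb] := top_face_enum Nb.
    rewrite -tF -sb; apply/esym/inj_range_eq => // i.
    by rewrite sb; apply: Fb; rewrite -tF; exists i.
  rewrite topE in xF; have [ho low] := open_cone_hinge n_gt0 xF.
  exists b, (in_chart R f b (b \o tperm i0 j0)), h; split=> //.
  by apply: Or31; rewrite (range_cone_label hl ha).
have [v /top_faceP[[i vi]|vf] FE] := facet_split Nb Fb Fn; last first.
  have Fh : F = range (edge h).
    rewrite FE; apply/seteqP; split=> w.
      move=> [/top_faceP[[i wi] _|wf wv]]; last first.
        by case: wv; apply: label_inj; rewrite wf vf.
      by exists i => //; apply: label_inj; rewrite hl wi.
    move=> [i _ <-]; split; first by apply/top_faceP; left; exists i.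
    by move=> /(congr1 label); rewrite hl vf.
  exists b, (in_chart R f b (b \o tperm i0 j0)), h; split=> //.
    by apply: edge_open; rewrite -?Fh.
  apply: Or32; split=> //; rewrite (@range_delta h) -?Fh// => i.
  exact: lower_vecE.
have [k kn] : exists k : 'I_n, k.+1 = n.
  have kn : (n.-1 < n)%N by rewrite prednK.
  by exists (Ordinal kn); rewrite /= prednK.
have [w fw] := upd_solve fq (b \o tperm i k) k (f b).
have Na := rotate_NCT Nb fw; set a := upd _ _ _ in fw Na.
have aE l : l != k -> a l = b (tperm i k l) by move=> lk; rewrite /a upd_neq.
have [z az] : exists z, opposite_entry f a z.
  have [k' k'n] := penultimate Na kn.
  exact: (opposite_solve fq kn k'n).
have [h' [hM' hE' hl']] := out_hinge Na kn az.
have Fh : F = range (edge h').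
  rewrite FE; apply/seteqP; split=> u.
    move=> [/top_faceP[[j uj] uv|uf _]]; last first.
      by exists k => //; apply: label_inj; rewrite hl' eqxx uf fw.
    have ji : j != i.
      by apply/eqP => ji; apply: uv; apply: label_inj; rewrite uj vi ji.
    have jk : tperm i k j != k by rewrite -[X in _ != X](tpermL i k) (inj_eq perm_inj).
    exists (tperm i k j) => //; apply: label_inj.
    by rewrite hl' (negPf jk) uj aE// tpermK.
  move=> [l _ <-]; split.
    apply/top_faceP; rewrite hl'; case: eqVneq => [_|lk]; first by right; rewrite fw.
    by left; exists (tperm i k l); rewrite aE.
  move=> /(congr1 label); rewrite hl' vi; case: eqVneq => // lk [].
  rewrite aE// => /(NCT_inj falt Nb) li; case/eqP: lk.
  by apply: (@perm_inj _ (tperm i k)); rewrite li tpermR.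
exists a, (out_chart R f a (a k) z), h'; split=> //.
  by apply: edge_open; rewrite -?Fh.
apply: Or33; split; first by exists k, z.
rewrite (@range_delta h') -?Fh// => l.
rewrite (out_facetE a l kn).
by have := hl' l; case: eqP => _ el; [exact: upper_vecE|exact: lower_vecE].
Qed.

Lemma atlas_hinged phi : atlas R f phi ->
  exists2 h : hinge V n, hinge_of (OSer R f) h & phi = hinge_chart h.
Proof.
move=> [a Na [[i [j [ij ->]]]|[k [z [kn az ->]]]]].
  by have [h [hM hE _ _]] := in_hinge Na ij; exists h.
by have [h [hM hE _]] := out_hinge Na kn az; exists h.
Qed.

Lemma atlas_covers x : OSer R f x ->
  exists phi u, [/\ atlas R f phi, Bipyr R n u & phi u = x].
Proof.
move=> /OSer_cover[a [phi [h [Na hM ho phiE cases]]]].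
exists phi, (hinge_coord h x); split; last by rewrite phiE coordK.
  by exists a => //; case: cases => -[]; [left|left|right].
exact: hinge_open_coord.
Qed.

End SerenationCharts.

Theorem proposition5p21 (R : realType) (n : nat) (A : Type)
    (f : ('I_n -> A) -> A) :
  (1 <= n)%N -> quasigroup f -> alternating_op f ->
  (exists g, standard_metric (R := R) f g) /\
  (forall g, standard_metric (R := R) f g ->
     riemannian_manifold (OSer R f) (Bipyr R n) (atlas R f) g /\
     flat (Bipyr R n) (atlas R f) g).
Proof.
move=> n_gt0 fq falt.
have hinged := @atlas_hinged R n A f n_gt0 fq falt.
have covered := @atlas_covers R n A f n_gt0 fq falt.
split.
  exists (chart_metric (atlas R f)).
  have gb := @chart_metric_bilinear R (vertex f) n (OSer R f) (atlas R f).
  have gs := chart_metric_somewhere n_gt0 hinged covered.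
  have gram1 := gram_const n_gt0 hinged gb gs.
  split=> //.
  - move=> a x Na ax i j X Y tX tY aX aY.
    have [i0 [j0 ij0]] := NCT_distinct Na.
    have [h [hM phiE hl ha]] := in_hinge (R := R) n_gt0 falt Na ij0.
    rewrite (range_cone_label hl ha) in ax; have [ho low] := open_cone_hinge n_gt0 ax.
    set phi := in_chart R f a _ in phiE.
    have Pphi : atlas R f phi by exists a => //; left; exists i0, j0.
    have Du := hinge_open_coord n_gt0 ho; set u := hinge_coord h x in Du low.
    have ux : phi u = x by rewrite phiE coordK.
    have coordE Z l : ambient f x Z (lower_vec R f (a l) - upper_vec R f (f a)) ->
        Z phi = delta_mx 0 l.
      move=> aZ; apply: (ambient_unique (h := h) low) => w; rewrite -phiE.
      have := aZ phi u Pphi Du ux w.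
      by rewrite (lower_vecE (hl l)) (upper_vecE ha).
    rewrite -ux in tX tY *.
    rewrite (metric_gdot n_gt0 hinged gb gs Pphi Du tX tY).
    by rewrite (coordE _ _ aX) (coordE _ _ aY) gdot_delta.
  - move=> a phi u Na ophi Du _ i j; apply: gram1 => //.
    by exists a => //; right.
  - move=> a phi u Na iphi Du _ i j; apply: gram1 => //.
    by exists a => //; left.
move=> g [gb g1 g2 g3].
(* The first rule is about ambient vectors; the edge vectors at the output are
   the ambient images of the coordinate vectors of an input chart. *)
have gs x : OSer R f x -> exists phi u, [/\ atlas R f phi, Bipyr R n u, phi u = x &
    forall i j, gram (Bipyr R n) (atlas R f) g phi u i j = 1 + (i == j)%:R].
  move=> /(OSer_cover n_gt0 fq falt)[a [phi [h [Na hM ho phiE cases]]]].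
  have Pphi : atlas R f phi.
    by exists a => //; case: cases => -[]; [left|left|right].
  have Du := hinge_open_coord n_gt0 ho.
  have ux : phi (hinge_coord h x) = x by rewrite phiE coordK.
  exists phi, (hinge_coord h x); split=> // i j.
  case: cases => [[_ low ax hl ha]|[iphi ax]|[ophi ax]].
  - rewrite mxE ux.
    have amb l : ambient f x (coord_tvec (Bipyr R n) (atlas R f) phi (hinge_coord h x) l)
        (lower_vec R f (a l) - upper_vec R f (f a)).
      move=> psi z Ppsi Dz zx w.
      rewrite (lower_vecE (hl l)) (upper_vecE ha).
      have zu := etrans zx (esym ux).
      exact: (ambient_coord n_gt0 hinged l w phiE Pphi Ppsi Du low Dz zu).
    have tan l : tangent (Bipyr R n) (atlas R f) x
        (coord_tvec (Bipyr R n) (atlas R f) phi (hinge_coord h x) l).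
      rewrite coord_tvecE; have := tvec_of_tangent n_gt0 hinged (delta_mx 0 l) Pphi Du.
      by rewrite ux.
    exact: (g1 a x Na ax i j).
  - by apply: (g3 a) => //; rewrite ux.
  - by apply: (g2 a) => //; rewrite ux.
split; last exact: (hinged_flat n_gt0 hinged gb gs).
split; first exact: hinged_smooth_manifold.
exact: (hinged_riemannian n_gt0 hinged covered gb gs).
Qed.
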